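(* Let $G$ be a mixed unit interval graph on $n$ vertices. Then $\mathrm{cwd}(G)\le 2\alpha(G)+3$, where $\alpha(G)$ is the maximum size of an independent set of $G$. Moreover, a $(2\alpha(G)+3)$-expression defining $G$ can be constructed in $O(n)$ time provided a $\mathcal{U}$-bubble model of $G$ is given.
   Context: Clique-width: $\mathrm{cwd}(G)$ is the smallest $k$ such that $G$ can be constructed using at most $k$ labels by the operations: creating a single vertex with label $i$; disjoint union $\oplus$; relabeling all labels $i$ to $j$; and, for $i\ne j$, adding all edges between vertices labelled $i$ and vertices labelled $j$. Such a term using at most $k$ labels is a $k$-expression. A mixed unit interval graph is an intersection graph of unit intervals, each closed, open or half-open. A 2-dimensional $\mathcal{U}$-bubble structure for a finite nonempty set $A$ is a family $\mathcal{B}=\langle B_{i,j}\rangle_{1\le j\le k,\,1\le i\le r_j}$ of pairwise disjoint (possibly empty) sets (''bubbles'') with union $A$, each partitioned into quadrants $B_{i,j}=B^{++}_{i,j}\cup B^{+-}_{i,j}\cup B^{-+}_{i,j}\cup B^{--}_{i,j}$; $B^{*+}_{i,j}=B^{++}_{i,j}\cup B^{-+}_{i,j}$, $B^{+*}_{i,j}=B^{++}_{i,j}\cup B^{+-}_{i,j}$. Column $j$ consists of the bubbles with second index $j$; row $i$ of those with first index $i$. The graph $G(\mathcal{B})$ has vertex set $A$, and distinct $u,v$ are adjacent iff, for some ordering, $u\in B_{i,j}$, $v\in B_{i',j'}$ and: (a) $j=j'$; or (b) $j=j'-1$ and $i>i'$; or (c) $j=j'-1$, $i=i'$, $u\in B^{*+}_{i,j}$,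 $v\in B^{+*}_{i',j'}$. A $\mathcal{U}$-bubble model of $G$ is such a structure for $V(G)$ with $G\cong G(\mathcal{B})$, every row and column containing a nonempty bubble, $B_{r_j,j}\ne\emptyset$ for all $j$, and with $\mathrm{top}(j)=\min\{i:B_{i,j}\ne\emptyset\}$, $\mathrm{top}(1)=1$, $\mathrm{top}(j)\le \mathrm{top}(j+1)$. *)

(* Defs.v *)
From HB Require Import structures.
From mathcomp Require Import all_boot all_order all_algebra.
From mathcomp Require Import boolp reals.

Set Implicit Arguments.
Unset Strict Implicit.
Unset Printing Implicit Defensive.

Import Order.TTheory GRing.Theory Num.Theory.

Record sgraph := SGraph {
  svertex :> finType;
  sedge : rel svertex;
  sedge_sym : symmetric sedge;
  sedge_irrefl : irreflexive sedge }.

Definition independent (G : sgraph) (S : {set G}) : bool :=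
  [forall x in S, forall y in S, ~~ sedge x y].

Definition alpha (G : sgraph) : nat :=
  \max_(S : {set G} | independent S) #|S|.

(* All four combinations of the booleans [bl], [br] are allowed: [BSide true]
   is a closed left end and an open right end, [BSide false] the converse. *)
Definition unit_interval (R : realType) (I : interval R) : Prop :=
  exists (a : R) (bl br : bool),
    I = Interval (BSide bl a) (BSide br (a + 1)%R).

Definition mixed_unit_interval_graph (R : realType) (G : sgraph) : Prop :=
  exists I : G -> interval R,
    (forall x, unit_interval (I x)) /\
    (forall x y, sedge x y <->
       x <> y /\ exists z : R, (z \in I x) && (z \in I y)).

Inductive cwterm :=
  | Vertex of nat
  | Union of cwterm & cwterm
  | Relabel of nat & nat & cwterm
  | Join of nat & nat & cwterm.

Record lgraph := LGraph {
  lvertex : finType;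
  ledge : rel lvertex;
  llabel : lvertex -> nat }.

Definition union_edge (A B : Type) (eA : rel A) (eB : rel B) : rel (A + B) :=
  fun u v => match u, v with
             | inl x, inl y => eA x y
             | inr x, inr y => eB x y
             | _, _ => false
             end.

Definition union_label (A B : Type) (lA : A -> nat) (lB : B -> nat)
    (u : A + B) : nat :=
  match u with inl x => lA x | inr y => lB y end.

Fixpoint value (t : cwterm) : lgraph :=
  match t with
  | Vertex i => @LGraph unit (fun _ _ => false) (fun _ => i)
  | Union t1 t2 =>
      @LGraph (lvertex (value t1) + lvertex (value t2))%type
        (union_edge (@ledge (value t1)) (@ledge (value t2)))
        (union_label (@llabel (value t1)) (@llabel (value t2)))
  | Relabel i j t1 =>
      @LGraph (lvertex (value t1)) (@ledge (value t1))
        (fun x => if llabel x == i then j else llabel x)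
  | Join i j t1 =>
      @LGraph (lvertex (value t1))
        (fun x y => [|| ledge x y,
                        (llabel x == i) && (llabel y == j) |
                        (llabel x == j) && (llabel y == i)])
        (@llabel (value t1))
  end.

Fixpoint labels (t : cwterm) : seq nat :=
  match t with
  | Vertex i => [:: i]
  | Union t1 t2 => labels t1 ++ labels t2
  | Relabel i j t1 => [:: i, j & labels t1]
  | Join i j t1 => [:: i, j & labels t1]
  end.

Fixpoint cwterm_wf (t : cwterm) : bool :=
  match t with
  | Vertex _ => true
  | Union t1 t2 => cwterm_wf t1 && cwterm_wf t2
  | Relabel _ _ t1 => cwterm_wf t1
  | Join i j t1 => (i != j) && cwterm_wf t1
  end.

Definition k_expression (k : nat) (t : cwterm) : bool :=
  cwterm_wf t && (size (undup (labels t)) <= k).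

Definition defines (t : cwterm) (G : sgraph) : Prop :=
  exists f : G -> lvertex (value t),
    bijective f /\ forall x y, sedge x y = ledge (f x) (f y).

(* No term builds the graph without vertices; its clique-width is 0. *)
Definition cwd_le (G : sgraph) (k : nat) : bool :=
  `[< #|G| = 0 \/ exists t, k_expression k t /\ defines t G >].

Section CwdExists.
Variable G : sgraph.

Let rk (x : G) : nat := enum_rank x.

Let rk_inj : injective rk.
Proof. by move=> x y /val_inj /enum_rank_inj. Qed.

Definition reps (t : cwterm) (s : seq G) (E : rel G) : Prop :=
  cwterm_wf t /\
  exists f : lvertex (value t) -> G,
    [/\ injective f, forall x, x \in s <-> exists a, f a = x,
        forall a b, ledge a b = E (f a) (f b)
      & forall a, llabel a = rk (f a)].

Let eq_reps t s E E' : {in s &, E =2 E'} -> reps t s E -> reps t s E'.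
Proof.
move=> eE [wt [f [fi fs fe fl]]]; split=> //; exists f; split=> // a b.
by rewrite fe eE //; apply/fs; [exists a | exists b].
Qed.

Let reps_joins y (l : seq G) t s E : y \notin l -> reps t s E ->
  exists t', reps t' s (fun u v => [|| E u v, (u == y) && (v \in l)
                                            | (v == y) && (u \in l)]).
Proof.
move=> yl rt; elim: l yl => [|z l IH] => [_|].
  by exists t; apply: eq_reps rt => u v _ _; rewrite !in_nil !andbF !orbF.
rewrite inE negb_or => /andP[yz /IH [t' [wt [f [fi fs fe fl]]]]].
exists (Join (rk y) (rk z) t'); split=> /=.
  by rewrite wt andbT; apply: contra yz => /eqP/rk_inj ->.
exists f; split=> // a b /=; rewrite fe !fl !(inj_eq rk_inj) !inE.
case: (E _ _) => //=; case: (f a == y); case: (f b == y);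
  case: (f a == z); case: (f b == z); rewrite ?orbT ?orbF //=;
  by case: (f a \in l); case: (f b \in l).
Qed.

Let reps_cons y t s E : y \notin s -> reps t s E ->
  reps (Union t (Vertex (rk y))) (y :: s)
    (fun u v => [&& E u v, u \in s & v \in s]).
Proof.
move=> ys [wt [f [fi fs fe fl]]]; split=> /=; first by rewrite wt.
have fin a : f a \in s by apply/fs; exists a.
pose g (u : lvertex (value t) + unit) := if u is inl a then f a else y.
exists g; split.
- move=> [a|[]] [b|[]] //= => [/fi -> // | ab | ab].
    by rewrite -ab fin in ys.
  by rewrite ab fin in ys.
- move=> x; rewrite inE; split.
    by case/orP=> [/eqP->|/fs [a <-]]; [exists (inr tt) | exists (inl a)].
  by move=> [[a|[]] <-] /=; rewrite ?eqxx // fin orbT.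
- by move=> [a|[]] [b|[]] //=; rewrite ?(negPf ys) ?andbF // fe !fin !andbT.
- by move=> [a|[]] //=; rewrite fl.
Qed.

Let reps_exists (s : seq G) : uniq s -> s != [::] ->
  exists t, reps t s (@sedge G).
Proof.
elim: s => // y s IH /= /andP[ys us] _.
case: (eqVneq s [::]) => [->|/(IH us) [t rt]].
  exists (Vertex (rk y)); split=> //; exists (fun=> y); split=> //.
  - by move=> [] [].
  - by move=> x; rewrite inE; split=> [/eqP->|[_ ->]]; [exists tt|].
  - by move=> a b /=; rewrite sedge_irrefl.
have /(_ y [seq z <- s | sedge y z]) := reps_joins _ (reps_cons ys rt).
rewrite mem_filter (negPf ys) andbF => /(_ isT) [t' rt']; exists t'.
apply: eq_reps rt' => u v; rewrite !mem_filter !inE.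
case: (eqVneq u y) => [->|uy]; case: (eqVneq v y) => [->|vy] //=.
- by rewrite (negPf ys) sedge_irrefl !andbF.
- by move=> _ ->; rewrite (negPf ys) andbF orbF andbT.
- by move=> -> _; rewrite (negPf ys) !andbF andbT sedge_sym.
- by move=> -> ->; rewrite !andbT orbF.
Qed.

Lemma cwd_exists : exists k, cwd_le G k.
Proof.
case: (posnP #|G|) => [G0|G0]; first by exists 0; apply/asboolP; left.
have [|t [wt [f [fi fs fe _]]]] := @reps_exists (enum G) (enum_uniq G).
  by rewrite -size_eq0 -cardE -lt0n.
exists (size (undup (labels t))); apply/asboolP; right; exists t.
split; first by rewrite /k_expression wt leqnn.
have fsurj x : {a | f a == x}.
  by apply: sigW; have /fs [a <-] := mem_enum G x; exists a.
pose g x := sval (fsurj x).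
have gK : cancel g f by move=> x; apply/eqP; exact: (svalP (fsurj x)).
exists g; split; last by move=> x y; rewrite fe !gK.
by exists f => // a; apply: fi; rewrite gK.
Qed.

End CwdExists.

Definition cwd (G : sgraph) : nat := ex_minn (cwd_exists G).

(* Indices are 1-based; [quadrant i j s t] is the quadrant of row i, column j
   with signs s t, [true] standing for +, and is empty when (i, j) is outside
   the index set. *)
Record bubble_structure (A : finType) := BubbleStructure {
  ncols : nat;
  nrows : nat -> nat;
  quadrant : nat -> nat -> bool -> bool -> {set A};
  bubble_carrier : 0 < #|A|;
  quadrant_index : forall x i j s t, x \in quadrant i j s t ->
    (1 <= j <= ncols) && (1 <= i <= nrows j);
  quadrant_cover : forall x, exists i j s t, x \in quadrant i j s t;
  quadrant_disjoint : forall x i j s t i' j' s' t',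
    x \in quadrant i j s t -> x \in quadrant i' j' s' t' ->
    [/\ i = i', j = j', s = s' & t = t'] }.

Section Bubble.
Variables (A : finType) (B : bubble_structure A).

Definition bubble (i j : nat) : {set A} :=
  quadrant B i j true true :|: quadrant B i j true false :|:
  quadrant B i j false true :|: quadrant B i j false false.

Definition bubble_xp (i j : nat) : {set A} :=
  quadrant B i j true true :|: quadrant B i j false true.

Definition bubble_px (i j : nat) : {set A} :=
  quadrant B i j true true :|: quadrant B i j true false.

Definition bubble_adj_ordered (u v : A) : Prop :=
  exists i j i' j', [/\ u \in bubble i j, v \in bubble i' j' &
    [\/ j = j',
        j.+1 = j' /\ i > i'
      | [/\ j.+1 = j', i = i', u \in bubble_xp i j & v \in bubble_px i' j']]].

Definition bubble_adj (u v : A) : Prop :=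
  u <> v /\ (bubble_adj_ordered u v \/ bubble_adj_ordered v u).

(* [find] returns the position in [iota 0 _], i.e., the row index itself;
   row 0 is always empty. *)
Definition top (j : nat) : nat :=
  find (fun i => bubble i j != set0) (iota 0 (nrows B j).+1).

End Bubble.

Definition bubble_model (G : sgraph) (B : bubble_structure G) : Prop :=
  (exists f : G -> G,
     bijective f /\ forall x y, sedge x y <-> bubble_adj B (f x) (f y)) /\
  [/\ forall j, 1 <= j <= ncols B ->
        exists i, bubble B i j != set0,
      forall i j, 1 <= j <= ncols B -> 1 <= i <= nrows B j ->
        exists j', bubble B i j' != set0,
      forall j, 1 <= j <= ncols B -> bubble B (nrows B j) j != set0,
      top B 1 = 1
    & forall j, 1 <= j < ncols B -> top B j <= top B j.+1].

(* Word RAM with finitely many registers and arrays in each program, +, -,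
   comparisons and indirect access, at unit cost.  Words range over 0..W; an
   instruction whose result exceeds W has no successor state.  Since Const and
   Add are the only instructions creating new values, all words of a run stay
   in 0..W as soon as the input does. *)
Inductive instr :=
  | Const of nat & nat           (* x := c *)
  | Add of nat & nat & nat       (* x := y + z *)
  | Sub of nat & nat & nat       (* x := y - z, truncated at 0 *)
  | Get of nat & nat & nat       (* x := a[y] *)
  | Put of nat & nat & nat       (* a[y] := x, arguments in the order a y x *)
  | Write of nat.                (* append x to the output *)

Inductive test := Lt of nat & nat | Eq of nat & nat.

Inductive prog :=
  | Skip
  | Do of instr
  | Seq of prog & prog
  | If of test & prog & prog
  | While of test & prog.

Record state := State {
  reg : nat -> nat;
  arr : nat -> nat -> nat;
  out : seq nat }.

Definition upd (T : Type) (f : nat -> T) (x : nat) (v : T) : nat -> T :=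
  fun y => if y == x then v else f y.

Definition set_reg (s : state) (x v : nat) : state :=
  State (upd (reg s) x v) (arr s) (out s).

Definition step (W : nat) (i : instr) (s : state) : option state :=
  match i with
  | Const x c => if c <= W then Some (set_reg s x c) else None
  | Add x y z =>
      if reg s y + reg s z <= W then Some (set_reg s x (reg s y + reg s z))
      else None
  | Sub x y z => Some (set_reg s x (reg s y - reg s z))
  | Get x a y => Some (set_reg s x (arr s a (reg s y)))
  | Put a y x =>
      Some (State (reg s)
                  (upd (arr s) a (upd (arr s a) (reg s y) (reg s x)))
                  (out s))
  | Write x => Some (State (reg s) (arr s) (rcons (out s) (reg s x)))
  end.

Definition holds (b : test) (s : state) : bool :=
  match b with
  | Lt x y => reg s x < reg s y
  | Eq x y => reg s x == reg s y
  end.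

(* [run W p s T s']: p started in s halts in s' after T steps. *)
Inductive run (W : nat) : prog -> state -> nat -> state -> Prop :=
  | RunSkip s : run W Skip s 0 s
  | RunDo i s s' : step W i s = Some s' -> run W (Do i) s 1 s'
  | RunSeq p q s T s1 T' s2 : run W p s T s1 -> run W q s1 T' s2 ->
      run W (Seq p q) s (T + T') s2
  | RunIfTrue b p q s T s' : holds b s -> run W p s T s' ->
      run W (If b p q) s T.+1 s'
  | RunIfFalse b p q s T s' : ~~ holds b s -> run W q s T s' ->
      run W (If b p q) s T.+1 s'
  | RunWhileTrue b p s T s1 T' s2 : holds b s -> run W p s T s1 ->
      run W (While b p) s1 T' s2 -> run W (While b p) s (T + T').+1 s2
  | RunWhileFalse b p s : ~~ holds b s -> run W (While b p) s 1 s.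

Record place := Place {
  prow : nat; pcol : nat; psign1 : bool; psign2 : bool }.

(* l gives, for the vertices of A numbered 0..#|A|-1 in some arbitrary order,
   the quadrant containing each of them. *)
Definition listing (A : finType) (B : bubble_structure A) (l : seq place) :
    Prop :=
  exists (e : seq A) (w : A -> place),
    [/\ perm_eq e (enum A),
        forall x, x \in quadrant B (prow (w x)) (pcol (w x))
                                   (psign1 (w x)) (psign2 (w x))
      & l = map w e].

(* Registers 0, 1: number of vertices, number of columns.  Arrays 0 to 3,
   indexed by vertices: row, column, first sign, second sign (+ is 1, - is 0).
   Array 4, indexed by columns j: r_j.  Everything else is 0.
   Storing the empty bubbles as well could take quadratic space. *)
Definition init (A : finType) (B : bubble_structure A) (l : seq place) :
    state :=
  State (nth 0 [:: size l; ncols B])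
        (nth (fun=> 0)
           [:: nth 0 (map prow l); nth 0 (map pcol l);
               nth 0 (map (fun p => psign1 p : nat) l);
               nth 0 (map (fun p => psign2 p : nat) l);
               fun j => if 1 <= j <= ncols B then nrows B j else 0])
        [::].

(* Reverse Polish notation: an opcode followed by its labels. *)
Fixpoint code (t : cwterm) : seq nat :=
  match t with
  | Vertex i => [:: 0; i]
  | Union t1 t2 => code t1 ++ code t2 ++ [:: 1]
  | Relabel i j t1 => code t1 ++ [:: 2; i; j]
  | Join i j t1 => code t1 ++ [:: 3; i; j]
  end.

(* Main.v *)
From HB Require Import structures.
Require Import Defs.
From mathcomp Require Import all_boot all_order all_algebra.
From mathcomp Require Import boolp reals.
From mathcomp Require Import zify lra.

Set Implicit Arguments.
Unset Strict Implicit.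
Unset Printing Implicit Defensive.

Import Order.TTheory GRing.Theory Num.Theory.

(**
The vertices are inserted row by row, and from left to right inside a row.  A
vertex of column j is then adjacent to all vertices already present in columns
j and j + 1, to some of those of its own row in column j - 1, and to nothing
else; so one label per column suffices, plus three: one for the new vertex and
two for the vertices with second sign + of the last two bubbles.  Columns of
equal parity have no edges between them, hence there are at most 2 alpha
nonempty columns.

For unit intervals with left end points a, the column is the integral part of
a and the row is the rank of its fractional part.  For the time bound, two
bucket sorts put the vertices in the required order; this is linear because
in a bubble model all rows and columns are nonempty, hence at most n.
*)

(** * Terms and the labelled graphs they represent *)

Definition represents (V : finType) (t : cwterm) (s : seq V) (E : rel V)
    (lab : V -> nat) : Prop :=
  exists f : lvertex (value t) -> V,
    [/\ injective f, forall x, x \in s <-> exists a, f a = x,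
        forall a b, ledge a b = E (f a) (f b)
      & forall a, llabel a = lab (f a)].

Definition opt_represents (V : finType) (o : option cwterm) (s : seq V)
    (E : rel V) (lab : V -> nat) : Prop :=
  if o is Some t then represents t s E lab else s = [::].

Definition join_all (i : nat) (js : seq nat) (t : cwterm) : cwterm :=
  foldl (fun t j => Join i j t) t js.

Arguments join_all : simpl never.

Definition add_vertex (i : nat) (o : option cwterm) : cwterm :=
  if o is Some t then Union t (Vertex i) else Vertex i.

Lemma code_join_all i js t :
  code (join_all i js t) = code t ++ flatten [seq [:: 3; i; j] | j <- js].
Proof.
elim: js t => [|j js IH] t /=; first by rewrite cats0.
by rewrite [LHS]IH /= -catA.
Qed.

Lemma cwterm_wf_join_all i js t :
  i \notin js -> cwterm_wf t -> cwterm_wf (join_all i js t).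
Proof.
elim: js t => //= j js IH t; rewrite inE negb_or => /andP[ij ijs] wf_t.
by apply: IH => //=; rewrite ij.
Qed.

Lemma all_labels_join_all (a : pred nat) i js t : a i -> all a js ->
  all a (labels t) -> all a (labels (join_all i js t)).
Proof.
move=> ai; elim: js t => //= j js IH t /andP[aj ajs] at_.
by apply: IH => //=; rewrite ai aj.
Qed.

Section Represents.
Variable V : finType.
Implicit Types (s : seq V) (E : rel V) (lab : V -> nat).

Lemma eq_represents t s E E' lab lab' :
  {in s &, E =2 E'} -> {in s, lab =1 lab'} ->
  represents t s E lab -> represents t s E' lab'.
Proof.
move=> eE el [f [f_inj f_im f_edge f_lab]]; exists f; split=> // [a b|a].
  by rewrite f_edge eE //; apply/f_im; [exists a | exists b].
by rewrite f_lab el //; apply/f_im; exists a.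
Qed.

Lemma represents_vertex i (x : V) :
  represents (Vertex i) [:: x] (fun _ _ => false) (fun=> i).
Proof.
exists (fun=> x); split=> //; first by move=> [] [].
by move=> y; rewrite inE; split=> [/eqP->|[_ ->]]; [exists tt|].
Qed.

Lemma represents_union_vertex t s E lab i x :
  x \notin s -> represents t s E lab ->
  represents (Union t (Vertex i)) (x :: s)
    (fun u v => [&& u \in s, v \in s & E u v])
    (fun u => if u == x then i else lab u).
Proof.
move=> xs [f [f_inj f_im f_edge f_lab]].
have f_in a : f a \in s by apply/f_im; exists a.
have fx a : (f a == x) = false by apply: contraNF xs => /eqP <-; exact: f_in.
pose g (u : lvertex (value t) + unit) := if u is inl a then f a else x.
exists g; split.
- move=> [a|[]] [b|[]] //= => [/f_inj -> // | /eqP | /esym/eqP]; by rewrite fx.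
- move=> y; rewrite inE; split.
    by case/orP=> [/eqP->|/f_im [a <-]]; [exists (inr tt) | exists (inl a)].
  by move=> [[a|[]] <-] /=; rewrite ?eqxx // f_in orbT.
- by move=> [a|[]] [b|[]] //=; rewrite ?(negPf xs) ?andbF // f_edge !f_in.
- by move=> [a|[]] /=; rewrite ?fx ?eqxx ?f_lab.
Qed.

Lemma represents_add_vertex o s E lab i x :
  x \notin s -> opt_represents o s E lab ->
  represents (add_vertex i o) (x :: s)
    (fun u v => [&& u \in s, v \in s & E u v])
    (fun u => if u == x then i else lab u).
Proof.
move=> xs; case: o => [t|/= s0]; first exact: represents_union_vertex.
rewrite s0; apply: eq_represents (represents_vertex i x) => // u.
by rewrite inE => ->.
Qed.

Lemma represents_join t s E lab i j : represents t s E lab ->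
  represents (Join i j t) s
    (fun u v => [|| E u v, (lab u == i) && (lab v == j)
                         | (lab u == j) && (lab v == i)]) lab.
Proof.
move=> [f [f_inj f_im f_edge f_lab]]; exists f; split=> //= a b.
by rewrite f_edge !f_lab.
Qed.

Lemma represents_relabel t s E lab i j : represents t s E lab ->
  represents (Relabel i j t) s E (fun u => if lab u == i then j else lab u).
Proof.
by move=> [f [f_inj f_im f_edge f_lab]]; exists f; split=> //= a; rewrite f_lab.
Qed.

Lemma represents_join_all t s E lab i js : represents t s E lab ->
  represents (join_all i js t) s
    (fun u v => [|| E u v, (lab u == i) && (lab v \in js)
                         | (lab u \in js) && (lab v == i)]) lab.
Proof.
elim: js t E => [|j js IH] t E rep.
  by apply: eq_represents rep => // u v _ _; rewrite andbF orbF.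
apply: eq_represents (IH _ _ (represents_join i j rep)) => // u v _ _.
by rewrite !inE andb_orr andb_orl -orbA orbACA.
Qed.

Lemma represents_join_new t s E lab x i js :
  symmetric E -> irreflexive E -> i \notin js -> x \notin s ->
  {in s, forall v, lab v != i} ->
  {in s, forall v, (lab v \in js) = E x v} ->
  let lab' u := if u == x then i else lab u in
  represents t (x :: s) (fun u v => [&& u \in s, v \in s & E u v]) lab' ->
  represents (join_all i js t) (x :: s) E lab'.
Proof.
move=> symE irrE ijs xs lab_i lab_js lab' /(represents_join_all i js).
apply: eq_represents => // u v; rewrite /lab' !inE.
have [->|_] := eqVneq u x; have [->|_] := eqVneq v x => //=.
- by rewrite eqxx irrE (negPf xs) (negPf ijs).
- by move=> _ vs; rewrite (negPf xs) eqxx lab_js // (negPf ijs) /= orbF.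
- move=> us _; rewrite (negPf xs) andbF eqxx lab_js // (negPf ijs) andbF /=.
  by rewrite andbT symE.
- move=> us vs; rewrite us vs (negPf (lab_i u us)) (negPf (lab_i v vs)).
  by rewrite andbF /= orbF.
Qed.

End Represents.

Lemma represents_defines (G : sgraph) t s (lab : G -> nat) :
  (forall x, x \in s) -> represents t s (@sedge G) lab -> defines t G.
Proof.
move=> alls [f [f_inj f_im f_edge _]].
have fsurj x : {a | f a == x}.
  by apply: sigW; have /f_im [a <-] := alls x; exists a.
pose g x := sval (fsurj x).
have gK : cancel g f by move=> x; apply/eqP; exact: (svalP (fsurj x)).
exists g; split; last by move=> x y; rewrite f_edge !gK.
by exists f => // a; apply: f_inj; rewrite gK.
Qed.

(** * Independent sets meeting every class *)

Lemma size_undup_map_le_alpha (G : sgraph) (T : eqType) (f : G -> T)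
    (A : {set G}) :
  {in A &, forall x y, sedge x y -> f x = f y} ->
  size (undup [seq f x | x in A]) <= alpha G.
Proof.
move=> fA; pose S := [set x in A | [pick y in A | f y == f x] == Some x].
have indS : independent S.
  apply/forall_inP => x; rewrite inE => /andP[xA /eqP px].
  apply/forall_inP => y; rewrite inE => /andP[yA /eqP py].
  apply/negP => exy; have fxy := fA x y xA yA exy.
  have [xy] : Some x = Some y by rewrite -px -py fxy.
  by rewrite xy sedge_irrefl in exy.
apply: (@leq_trans #|S|); last first.
  exact: (@leq_bigmax_cond _ (@independent G) (fun B => #|B|)).
rewrite cardE -(size_map f); apply: uniq_leq_size => [|i].
  exact: undup_uniq.
rewrite mem_undup => /mapP[x]; rewrite mem_enum => xA ->.
case pickE: [pick y in A | f y == f x] => [y|]; move: (pickE); last first.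
  by case: pickP => // /(_ x); rewrite xA eqxx.
case: pickP => // z /andP[zA /eqP fzx] [zy]; subst z.
by apply/mapP; exists y; rewrite // mem_enum inE zA fzx pickE /=.
Qed.

Lemma size_undup_layers_le_alpha (G : sgraph) (f : G -> nat) :
  (forall x y, sedge x y -> (f x <= (f y).+1) && (f y <= (f x).+1)) ->
  size (undup [seq f x | x : G]) <= 2 * alpha G.
Proof.
move=> f_edge; pose A b := [set x | odd (f x) == b].
have A_le b : size (undup [seq f x | x in A b]) <= alpha G.
  apply: size_undup_map_le_alpha => x y; rewrite !inE.
  by move=> /eqP xb /eqP yb /f_edge; lia.
rewrite mul2n -addnn.
apply: leq_trans (leq_add (A_le true) (A_le false)); rewrite -size_cat.
apply: uniq_leq_size (undup_uniq _) _ => i; rewrite mem_undup => /mapP[x _ ->].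
rewrite mem_cat !mem_undup.
by case: (boolP (odd (f x))) => fx; apply/orP; [left | right];
  rewrite map_f // mem_enum inE ?fx ?(negPf fx).
Qed.

(** * Placements of a graph in rows and columns *)

Definition place_tuple (p : place) : nat * nat * bool * bool :=
  (prow p, pcol p, psign1 p, psign2 p).

Definition tuple_place (u : nat * nat * bool * bool) : place :=
  let: (i, j, s1, s2) := u in Place i j s1 s2.

Lemma place_tupleK : cancel place_tuple tuple_place.
Proof. by case. Qed.

HB.instance Definition _ := Equality.copy place (can_type place_tupleK).

Definition place_next (p q : place) : bool :=
  ((pcol p).+1 == pcol q) &&
  ((prow q < prow p) || [&& prow p == prow q, psign2 p & psign1 q]).

Definition place_adj (p q : place) : bool :=
  [|| pcol p == pcol q, place_next p q | place_next q p].

Lemma place_adj_sym : symmetric place_adj.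
Proof. by move=> p q; rewrite /place_adj eq_sym; congr orb; exact: orbC. Qed.

Definition placement (G : sgraph) (pl : G -> place) : Prop :=
  forall x y, sedge x y = (x != y) && place_adj (pl x) (pl y).

Definition key (p : place) : nat *l nat := (prow p, pcol p).

(** * The term built from a list of places *)

Record window := Window {
  prev_bubble : nat *l nat;
  cur_bubble : nat *l nat }.

Section Build.
Variables (k : nat) (occupied : pred nat).

(* Label [0] is for the vertex being added, [k.+1] and [k.+2] for the vertices
   with second sign + of the last two nonempty bubbles met, and the column of a
   vertex for all the others. *)
Definition place_label (w : window) (p : place) : nat :=
  if psign2 p && (key p == cur_bubble w) then k.+2
  else if psign2 p && (key p == prev_bubble w) then k.+1 else pcol p.

Definition slide (w : window) (p : place) : window :=
  if key p == cur_bubble w then w else Window (cur_bubble w) (key p).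

Definition slide_term (w : window) (p : place) (t : cwterm) : cwterm :=
  if key p == cur_bubble w then t
  else Relabel k.+2 k.+1 (Relabel k.+1 (prev_bubble w).2 t).

(* Adjacency to a vertex with second sign + of a bubble [b] before [key p]. *)
Definition meets (b : nat * nat) (p : place) : bool :=
  [|| b.2 == pcol p, b.2 == (pcol p).+1
    | [&& b.2.+1 == pcol p, b.1 == prow p & psign1 p]].

Definition neighbour_labels (w : window) (p : place) : seq nat :=
  mask [:: true; occupied (pcol p).+1; true; meets (prev_bubble w) p]
       [:: pcol p; (pcol p).+1; k.+2; k.+1].

Definition extend_term (o : option cwterm) (w : window) (p : place) : cwterm :=
  Relabel 0 (place_label (slide w p) p)
    (join_all 0 (neighbour_labels (slide w p) p)
      (slide_term w p (add_vertex 0 o))).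

Definition add_place (st : option cwterm * window) (p : place) :
    option cwterm * window :=
  (Some (extend_term st.1 st.2 p), slide st.2 p).

(* Columns being positive, no bubble has index [(0, 0)]. *)
Definition build (ps : seq place) : option cwterm * window :=
  foldl add_place (None, Window (0, 0) (0, 0)) ps.

(* No bubble strictly between the two of [w] was met, so the only vertices that
   a new vertex of [cur_bubble w] may have to distinguish inside their column
   are labelled [k.+1]. *)
Definition settled (w : window) (p : place) : bool :=
  (key p == cur_bubble w) || (key p <= prev_bubble w < cur_bubble w)%O.

Definition usable (i : nat) : bool := (i \in [:: 0; k.+1; k.+2]) || occupied i.

Definition usable_term (t : cwterm) : bool :=
  cwterm_wf t && all usable (labels t).

Lemma cur_bubble_slide w p : cur_bubble (slide w p) = key p.
Proof. by rewrite /slide; case: eqP. Qed.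

Lemma cur_bubble_build ps : cur_bubble (build ps).2 = last (0, 0) (map key ps).
Proof.
case/lastP: ps => // ps p.
by rewrite /build foldl_rcons map_rcons last_rcons /= cur_bubble_slide.
Qed.

Lemma settled_slide w p q : (cur_bubble w <= key p)%O -> settled w q ->
  settled (slide w p) q.
Proof.
rewrite /slide; case: eqVneq => // ne le_cur; rewrite /settled /=.
have lt_cur : (cur_bubble w < key p)%O by rewrite lt_neqAle eq_sym ne.
case/orP=> [/eqP->|/andP[le_prev lt_prev]]; first by rewrite lexx lt_cur orbT.
by rewrite (le_trans le_prev (ltW lt_prev)) lt_cur orbT.
Qed.

Lemma place_label_slide w p q : pcol q <= k -> settled w q ->
  (cur_bubble w <= key p)%O -> key p != cur_bubble w ->
  let i := place_label w q in
  let j := if i == k.+1 then (prev_bubble w).2 else i in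
  (if j == k.+2 then k.+1 else j) = place_label (slide w p) q.
Proof.
move=> cq sq le_cur ne; rewrite /slide (negPf ne) /place_label /=.
have [ck1 ck2] : pcol q != k.+1 /\ pcol q != k.+2 by lia.
case/orP: sq => [/eqP->|/andP[le_prev lt_prev]].
  rewrite [_ == key p]eq_sym (negPf ne) !eqxx andbF andbT.
  case: (psign2 q); first by rewrite eqn_leq ltnn eqxx.
  by rewrite (negPf ck1) (negPf ck2).
have lt_cur := le_lt_trans le_prev lt_prev.
rewrite (lt_eqF lt_cur) (lt_eqF (lt_le_trans lt_cur le_cur)) !andbF.
case: (psign2 q); last by rewrite (negPf ck1) (negPf ck2).
case: (eqVneq (key q)) => [<-|_] /=; last by rewrite (negPf ck1) (negPf ck2).
by rewrite eqxx (negPf ck2).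
Qed.

Lemma place_adj_earlier p q : (key q < key p)%O ->
  place_adj p q = [|| pcol q == pcol p, pcol q == (pcol p).+1
                    | psign2 q && meets (key q) p].
Proof.
rewrite ltEprodlexi /place_adj /place_next /meets /=.
by case: (psign1 p) (psign2 q) => [] []; lia.
Qed.

Lemma meets_before_prev b p q : (key q < b)%O -> (b < key p)%O ->
  meets (key q) p = (pcol q == pcol p) || (pcol q == (pcol p).+1).
Proof.
by rewrite !ltEprodlexi /meets /=; case: (psign1 p); lia.
Qed.

Hypothesis occupied_bound : forall j, occupied j -> 0 < j <= k.

Lemma mem_neighbour_labels w p i : i \in neighbour_labels w p =
  [|| i == pcol p, (i == (pcol p).+1) && occupied i, i == k.+2
    | (i == k.+1) && meets (prev_bubble w) p].
Proof.
have [->|ne] := eqVneq i (pcol p).+1; rewrite /neighbour_labels;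
  case: (occupied _) (meets _ _) => [] [] /=; rewrite !inE; lia.
Qed.

Lemma place_label_neighbourE w p q :
  occupied (pcol p) -> occupied (pcol q) ->
  cur_bubble w = key p -> settled w q ->
  (place_label w q \in neighbour_labels w p) = place_adj p q.
Proof.
move=> occ_p occ_q cur_p; rewrite /settled /place_label cur_p.
have /andP[_ pk] := occupied_bound occ_p.
have /andP[_ qk] := occupied_bound occ_q.
have mem_col : (pcol q \in neighbour_labels w p) =
    (pcol q == pcol p) || (pcol q == (pcol p).+1).
  by rewrite mem_neighbour_labels occ_q; lia.
have mem_prev : (k.+1 \in neighbour_labels w p) = meets (prev_bubble w) p.
  have occN : ~~ occupied k.+1.
    by apply/negP => /occupied_bound; rewrite ltnn andbF.
  by rewrite mem_neighbour_labels (negPf occN); lia.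
case/orP=> [/eqP qp|/andP[le_prev lt_prev]].
  have [_ col_qp] := qp; rewrite /place_adj qp eqxx andbT.
  case: (psign2 q); last by rewrite mem_col col_qp eqxx.
  by rewrite mem_neighbour_labels col_qp !eqxx !orbT.
have lt_cur := le_lt_trans le_prev lt_prev.
rewrite place_adj_earlier // (lt_eqF lt_cur) andbF.
case: (psign2 q) => /=; last by rewrite mem_col orbF.
move: le_prev; rewrite le_eqVlt; case: eqVneq => [e|_ /= lt_q].
  by rewrite mem_prev -e /meets /=; do 2!case: (pcol q == _).
by rewrite mem_col (meets_before_prev lt_q lt_prev); do 2!case: (pcol q == _).
Qed.

Lemma place_label_neq0 w p : occupied (pcol p) -> place_label w p != 0.
Proof.
by move=> /occupied_bound; rewrite /place_label; do 2!case: ifP => // _; lia.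
Qed.

Lemma neighbour_labels_neq0 w p :
  occupied (pcol p) -> 0 \notin neighbour_labels w p.
Proof. by move=> /occupied_bound; rewrite mem_neighbour_labels; lia. Qed.

Lemma usable_place_label w p : occupied (pcol p) -> usable (place_label w p).
Proof.
move=> occ_p; rewrite /usable /place_label !inE.
by case: ifP => [_|_]; [|case: ifP => _]; rewrite ?occ_p ?eqxx ?orbT.
Qed.

Lemma all_usable_neighbour_labels w p :
  occupied (pcol p) -> all usable (neighbour_labels w p).
Proof.
move=> occ_p; apply/allP => i; rewrite mem_neighbour_labels /usable !inE.
by case/or4P=> [/eqP->|/andP[_ ->]|->|/andP[->]]; rewrite ?occ_p ?orbT.
Qed.

Lemma usable_add_vertex o :
  oapp usable_term true o -> usable_term (add_vertex 0 o).
Proof.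
by case: o => //= t; rewrite /usable_term /= all_cat => /andP[-> ->].
Qed.

Lemma usable_slide_term w p t : usable (prev_bubble w).2 ->
  usable_term t -> usable_term (slide_term w p t).
Proof.
rewrite /slide_term; case: ifP => // _ prev_us /andP[wf us].
by rewrite /usable_term /= wf us prev_us /usable !inE !eqxx !orbT.
Qed.

Lemma usable_extend_term o w p : occupied (pcol p) ->
  usable (prev_bubble w).2 -> oapp usable_term true o ->
  usable_term (extend_term o w p).
Proof.
move=> occ_p prev_us /usable_add_vertex.
move=> /(usable_slide_term p prev_us)/andP[wf us].
rewrite /usable_term /= cwterm_wf_join_all ?neighbour_labels_neq0 //.
rewrite usable_place_label //=.
by rewrite all_labels_join_all ?all_usable_neighbour_labels.
Qed.

Section Correct.
Variables (G : sgraph) (pl : G -> place).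
Hypothesis pl_placement : placement pl.
Hypothesis occupied_pl : forall x, occupied (pcol (pl x)).

Lemma represents_slide_term t s E w x :
  {in s, forall u, settled w (pl u)} -> (cur_bubble w <= key (pl x))%O ->
  represents t (x :: s) E
    (fun u => if u == x then 0 else place_label w (pl u)) ->
  represents (slide_term w (pl x) t) (x :: s) E
    (fun u => if u == x then 0 else place_label (slide w (pl x)) (pl u)).
Proof.
move=> sw le_cur rep; rewrite /slide_term.
case: eqVneq => [e|ne]; first by rewrite /slide e eqxx.
have := represents_relabel k.+2 k.+1
  (represents_relabel k.+1 (prev_bubble w).2 rep).
apply: eq_represents => // u; rewrite inE; case: eqVneq => //= _ us.
have /andP[_ uk] := occupied_bound (occupied_pl u).
exact: place_label_slide (sw u us) le_cur ne.
Qed.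

Lemma represents_extend_term s o w x : x \notin s ->
  {in s, forall u, settled w (pl u)} -> (cur_bubble w <= key (pl x))%O ->
  opt_represents o s (@sedge G) (fun u => place_label w (pl u)) ->
  represents (extend_term o w (pl x)) (x :: s) (@sedge G)
    (fun u => place_label (slide w (pl x)) (pl u)).
Proof.
move=> xs sw le_cur /(represents_add_vertex 0 xs).
move=> /(represents_slide_term sw le_cur) rep.
have lab_neq0 u : place_label (slide w (pl x)) (pl u) != 0.
  exact: place_label_neq0.
have adjE : {in s, forall u, (place_label (slide w (pl x)) (pl u)
    \in neighbour_labels (slide w (pl x)) (pl x)) = sedge x u}.
  move=> u us; rewrite pl_placement eq_sym (memPn xs u us) /=.
  apply: place_label_neighbourE => //; first exact: cur_bubble_slide.
  exact: settled_slide (sw u us).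
have {rep} := represents_relabel 0 (place_label (slide w (pl x)) (pl x))
  (represents_join_new (@sedge_sym G) (@sedge_irrefl G)
    (neighbour_labels_neq0 _ (occupied_pl x)) xs (in1W lab_neq0) adjE rep).
apply: eq_represents => // u _.
by have [->|_] := eqVneq u x; rewrite ?eqxx ?(negPf (lab_neq0 u)).
Qed.

Definition built (s : seq G) (st : option cwterm * window) : Prop :=
  [/\ {in s, forall x, settled st.2 (pl x)},
      usable (prev_bubble st.2).2, usable (cur_bubble st.2).2,
      oapp usable_term true st.1
    & opt_represents st.1 s (@sedge G) (fun x => place_label st.2 (pl x))].

Lemma add_place_built s st x : x \notin s ->
  (cur_bubble st.2 <= key (pl x))%O -> built s st ->
  built (x :: s) (add_place st (pl x)).
Proof.
move=> xs le_cur [sw prev_us cur_us wf rep]; split.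
- move=> u; rewrite inE => /orP[/eqP->|/sw]; last exact: settled_slide.
  by rewrite /settled cur_bubble_slide eqxx.
- by rewrite /= /slide; case: ifP.
- by rewrite /= cur_bubble_slide /usable occupied_pl orbT.
- exact: usable_extend_term.
- exact: represents_extend_term.
Qed.

Lemma build_built s : uniq s -> sorted <=%O [seq key (pl x) | x <- s] ->
  built (rev s) (build [seq pl x | x <- s]).
Proof.
move=> s_uniq; rewrite -(@path_min_sorted _ _ (0, 0)); last first.
  by apply/allP => -[i j] _; rewrite leEprodlexi /=; case: i.
elim/last_ind: s s_uniq => // s x IH.
rewrite rcons_uniq map_rcons rcons_path.
move=> /andP[xs s_uniq] /andP[s_sorted le_x].
rewrite rev_rcons map_rcons /build foldl_rcons.
apply: add_place_built (IH s_uniq s_sorted); first by rewrite mem_rev.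
by rewrite cur_bubble_build -map_comp.
Qed.

End Correct.
End Build.

Lemma usable_term_k_expression k (occupied : pred nat) (G : sgraph)
    (pl : G -> place) t : placement pl ->
  (forall j, occupied j -> exists x, pcol (pl x) = j) ->
  usable_term k occupied t -> k_expression (2 * alpha G + 3) t.
Proof.
move=> pl_placement occP /andP[wf us]; rewrite /k_expression wf /=.
pose cols := undup [seq pcol (pl x) | x : G].
apply: (@leq_trans (size (cols ++ [:: 0; k.+1; k.+2]))).
  apply: uniq_leq_size (undup_uniq _) _ => i; rewrite mem_undup mem_cat.
  move/(allP us); rewrite /usable orbC => /orP[/occP[x <-]|->].
    by rewrite mem_undup (map_f (fun y => pcol (pl y))) ?mem_enum.
  by rewrite orbT.
rewrite size_cat leq_add2r; apply: size_undup_layers_le_alpha => x y.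
by rewrite pl_placement /place_adj /place_next; lia.
Qed.

Lemma perm_map_exists (T1 T2 : eqType) (f : T1 -> T2) s t :
  perm_eq s (map f t) -> exists2 t', perm_eq t' t & s = map f t'.
Proof.
case: t => [|x t]; first by move=> /perm_nilP->; exists [::].
move=> /(perm_iotaP (f x))[o o_perm ->]; exists [seq nth x (x :: t) i | i <- o].
  by apply/(perm_iotaP x); exists o; rewrite // -(size_map f).
rewrite -map_comp; apply/eq_in_map => i; rewrite (perm_mem o_perm) mem_iota.
by rewrite size_map => /andP[_ io]; rewrite (nth_map x).
Qed.

Lemma build_k_expression k (occupied : pred nat) (G : sgraph)
    (pl : G -> place) (ps : seq place) :
  placement pl -> 0 < #|G| ->
  (forall j, occupied j -> 0 < j <= k) ->
  (forall j, occupied j <-> exists x, pcol (pl x) = j) ->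
  perm_eq ps [seq pl x | x : G] -> sorted <=%O (map key ps) ->
  exists t, [/\ (build k occupied ps).1 = Some t,
    k_expression (2 * alpha G + 3) t & defines t G].
Proof.
move=> pl_placement G0 occ_bound occP /perm_map_exists[s s_perm ->].
rewrite -map_comp => s_sorted.
have occ_pl x : occupied (pcol (pl x)) by apply/occP; exists x.
have s_uniq : uniq s by rewrite (perm_uniq s_perm) enum_uniq.
have [_ _ _] := build_built occ_bound pl_placement occ_pl s_uniq s_sorted.
case: (build _ _ _).1 => [t /= us rep|_ /eqP]; last first.
  by rewrite -size_eq0 size_rev (perm_size s_perm) -cardE gtn_eqF.
exists t; split=> //.
  by apply: usable_term_k_expression us => // j /occP.
apply: represents_defines rep => x.
by rewrite mem_rev (perm_mem s_perm) mem_enum.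
Qed.

(** * Running time of RAM programs *)

Local Coercion Do : instr >-> prog.
Local Notation "p ;; q" := (Seq p q) (at level 61, right associativity).

Definition ends (W : nat) (p : prog) (s : state) (C : nat)
    (Q : state -> Prop) : Prop :=
  exists T s', [/\ run W p s T s', T <= C & Q s'].

Definition fits (W : nat) (i : instr) (s : state) : bool :=
  match i with
  | Const _ c => c <= W
  | Add _ y z => reg s y + reg s z <= W
  | _ => true
  end.

Definition effect (i : instr) (s : state) : state :=
  match i with
  | Const x c => set_reg s x c
  | Add x y z => set_reg s x (reg s y + reg s z)
  | Defs.Sub x y z => set_reg s x (reg s y - reg s z)
  | Get x a y => set_reg s x (arr s a (reg s y))
  | Put a y x => State (reg s)
                   (upd (arr s) a (upd (arr s a) (reg s y) (reg s x)))
                   (out s)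
  | Write x => State (reg s) (arr s) (rcons (out s) (reg s x))
  end.

(* [wp] and [cost] are meant for loop-free programs: their values on [While]
   are junk, and [False] makes [wp] sound. *)
Fixpoint wp (W : nat) (p : prog) (Q : state -> Prop) (s : state) : Prop :=
  match p with
  | Skip => Q s
  | Do i => fits W i s /\ Q (effect i s)
  | Seq p q => wp W p (wp W q Q) s
  | If b p q => if holds b s then wp W p Q s else wp W q Q s
  | While _ _ => False
  end.

Fixpoint cost (p : prog) : nat :=
  match p with
  | Skip => 0
  | Do _ => 1
  | Seq p q => cost p + cost q
  | If _ p q => (maxn (cost p) (cost q)).+1
  | While _ _ => 0
  end.

Section Logic.
Variable W : nat.
Implicit Types (p q : prog) (s : state) (P Q : state -> Prop).

Lemma step_effect i s : fits W i s -> step W i s = Some (effect i s).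
Proof. by case: i => //= *; case: ifP => //; lia. Qed.

Lemma wp_mono p P Q s : (forall s', P s' -> Q s') -> wp W p P s -> wp W p Q s.
Proof.
elim: p P Q s => [|i|p IHp q IHq|b p IHp q IHq|b p IHp] //= P Q s PQ.
- exact: PQ.
- by move=> [-> /PQ].
- by apply: IHp => s'; exact: IHq.
- by case: ifP => _; [exact: IHp | exact: IHq].
Qed.

Lemma wp_seq p q P Q s : wp W p P s -> (forall s', P s' -> wp W q Q s') ->
  wp W (p ;; q) Q s.
Proof. by move=> wp_p wp_q; apply: wp_mono wp_p. Qed.

Lemma wp_if b p q Q s : (holds b s -> wp W p Q s) ->
  (~~ holds b s -> wp W q Q s) -> wp W (If b p q) Q s.
Proof. by move=> wp_p wp_q /=; case: ifPn. Qed.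

Lemma ends_mono p C D P Q s : C <= D -> (forall s', P s' -> Q s') ->
  ends W p s C P -> ends W p s D Q.
Proof.
move=> CD PQ [T [s' [run_s TC Ps']]].
by exists T, s'; split; [|exact: leq_trans TC CD|exact: PQ].
Qed.

Lemma ends_seq p q s C D P Q : ends W p s C P ->
  (forall s', P s' -> ends W q s' D Q) -> ends W (p ;; q) s (C + D) Q.
Proof.
move=> [T1 [s1 [run1 T1le P1]]] /(_ _ P1)[T2 [s2 [run2 T2le Q2]]].
exists (T1 + T2), s2; split=> //; last exact: leq_add.
exact: RunSeq run1 run2.
Qed.

Lemma wp_ends p Q s : wp W p Q s -> ends W p s (cost p) Q.
Proof.
elim: p Q s => [|i|p IHp q IHq|b p IHp q IHq|b p IHp] //= Q s.
- by move=> Qs; exists 0, s; split=> //; constructor.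
- move=> [fits_i Qs]; exists 1, (effect i s); split=> //.
  by constructor; exact: step_effect.
- by move=> /IHp pq; apply: ends_seq pq _ => s'; exact: IHq.
- case: ifPn => bs => [/IHp|/IHq] [T [s' [run_s Tle Qs']]].
  + exists T.+1, s'; split=> //; first exact: RunIfTrue.
    by rewrite ltnS leq_max Tle.
  + exists T.+1, s'; split=> //; first exact: RunIfFalse.
    by rewrite ltnS leq_max Tle orbT.
Qed.

Lemma ends_while b p (I : state -> Prop) (mu : state -> nat) s :
  (forall s, I s -> holds b s ->
     wp W p (fun s' => I s' /\ mu s' < mu s) s) ->
  I s ->
  ends W (While b p) s (mu s * (cost p).+1 + 1)
    (fun s' => I s' /\ ~~ holds b s').
Proof.
move=> body; move: {2}(mu s) (erefl (mu s)) => m.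
elim/ltn_ind: m s => m IH s mE Is; rewrite mE.
have [bs|bs] := boolP (holds b s); last first.
  by exists 1, s; split=> //; [exact: RunWhileFalse | rewrite leq_addl].
have [T1 [s1 [run1 T1le [I1 mu1]]]] := wp_ends (body _ Is bs).
rewrite mE in mu1; have [T2 [s2 [run2 T2le Q2]]] := IH _ mu1 s1 erefl I1.
exists (T1 + T2).+1, s2; split=> //; first exact: RunWhileTrue bs run1 run2.
have : (mu s1).+1 * (cost p).+1 <= m * (cost p).+1.
  by rewrite leq_mul2r mu1 orbT.
by rewrite mulSn; lia.
Qed.

End Logic.

Definition frame (R A : seq nat) (s s' : state) : Prop :=
  {in [predC R], reg s' =1 reg s} /\ {in [predC A], arr s' =1 arr s}.

Definition emits (R o : seq nat) (s s' : state) : Prop :=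
  frame R [::] s s' /\ out s' = out s ++ o.

Lemma emits_refl R s : emits R [::] s s.
Proof. by split; rewrite ?cats0. Qed.

Lemma frame_set_reg R A s s' x v :
  x \in R -> frame R A s s' -> frame R A s (set_reg s' x v).
Proof.
move=> xR [r a]; split=> // y; rewrite inE /= => yR.
by rewrite /upd; case: eqP yR => [->|_ yR]; [rewrite xR | exact: r].
Qed.

Lemma emits_set_reg R o s s' x v :
  x \in R -> emits R o s s' -> emits R o s (set_reg s' x v).
Proof. by move=> xR [f e]; split=> //; exact: frame_set_reg. Qed.

Lemma frame_reg R A xs s s' :
  frame R A s s' -> all [predC R] xs -> {in xs, reg s' =1 reg s}.
Proof. by move=> [regE _] /allP xsR x /xsR; exact: regE. Qed.

Lemma frame_arr R A xs s s' :
  frame R A s s' -> all [predC A] xs -> {in xs, arr s' =1 arr s}.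
Proof. by move=> [_ arrE] /allP xsA x /xsA; exact: arrE. Qed.

Lemma frame_trans R1 A1 R2 A2 s1 s2 s3 :
  frame R1 A1 s1 s2 -> frame R2 A2 s2 s3 -> frame (R1 ++ R2) (A1 ++ A2) s1 s3.
Proof.
move=> [reg1 arr1] [reg2 arr2]; split=> x.
  by rewrite inE /= mem_cat negb_or => /andP[x1 x2]; rewrite reg2 ?inE //= reg1.
by rewrite inE /= mem_cat negb_or => /andP[x1 x2]; rewrite arr2 ?inE //= arr1.
Qed.

Lemma emits_trans R1 R2 o1 o2 s1 s2 s3 :
  emits R1 o1 s1 s2 -> emits R2 o2 s2 s3 -> emits (R1 ++ R2) (o1 ++ o2) s1 s3.
Proof.
move=> [f1 e1] [f2 e2]; split; last by rewrite e2 e1 catA.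
exact: frame_trans f1 f2.
Qed.

Lemma frameS R A R' A' s s' : {subset R <= R'} -> {subset A <= A'} ->
  frame R A s s' -> frame R' A' s s'.
Proof.
move=> RR AA [r a]; split=> x; rewrite inE /= => x'.
  by apply: r; rewrite inE /=; apply: contra x' => /RR.
by apply: a; rewrite inE /=; apply: contra x' => /AA.
Qed.

(** * Bucket sort with linked lists *)

(* Lists are stored as pointers [v.+1] to the vertex [v], 0 being the end. *)
Fixpoint chain (nx : nat -> nat) (v : nat) (l : seq nat) : Prop :=
  if l is x :: l' then v = x.+1 /\ chain nx (nx x) l' else v = 0.

Lemma chain_upd nx v x y l :
  x \notin l -> chain nx v l -> chain (upd nx x y) v l.
Proof.
elim: l v => //= z l IH v; rewrite inE negb_or => /andP[xz xl] [-> ch].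
by split=> //; rewrite /upd eq_sym (negPf xz); exact: IH.
Qed.

Lemma pairwise_rev (T : Type) (r : rel T) s :
  pairwise r (rev s) = pairwise (fun x y => r y x) s.
Proof.
elim: s => //= x s IH; rewrite rev_cons -cats1 pairwise_cat IH /= andbT.
by rewrite allrel1r all_rev.
Qed.

Section Buckets.
Variables (T : eqType) (f : T -> nat).
Implicit Types (L : seq T) (M : nat).

(* The order is reversed, as when the elements are pushed on stacks. *)
Definition bucket L (i : nat) : seq T := rev [seq v <- L | f v == i].

Definition buckets L M : seq T := flatten [seq bucket L i | i <- iota 0 M].

Lemma mem_bucket L i v : (v \in bucket L i) = (f v == i) && (v \in L).
Proof. by rewrite mem_rev mem_filter. Qed.

Lemma bucket_rcons L v i :
  bucket (rcons L v) i = if f v == i then v :: bucket L i else bucket L i.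
Proof.
by rewrite /bucket filter_rcons; case: ifP => // _; rewrite rev_rcons.
Qed.

Lemma bucketsS L M : buckets L M.+1 = buckets L M ++ bucket L M.
Proof. by rewrite /buckets -addn1 iotaD map_cat flatten_cat /= cats0. Qed.

Lemma mem_buckets L M v : v \in buckets L M = (f v < M) && (v \in L).
Proof.
elim: M => // M IH; rewrite bucketsS mem_cat IH mem_bucket ltnS.
by rewrite [f v <= M]leq_eqVlt andb_orl orbC.
Qed.

Lemma perm_buckets L M : {in L, forall v, f v < M} -> perm_eq (buckets L M) L.
Proof.
move=> fM; have e : [seq v <- L | f v < M] = L by apply/all_filterP/allP.
rewrite -{2}e; elim: M {fM e} => [|M IH]; first by rewrite filter_pred0.
have lt_ltS v : predI (fun v => f v < M) (fun v => f v < M.+1) v = (f v < M).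
  by rewrite /=; lia.
have ge_ltS v :
    predI (predC (fun v => f v < M)) (fun v => f v < M.+1) v = (f v == M).
  by rewrite /=; lia.
rewrite bucketsS -(permPr (permEl (perm_filterC (fun v => f v < M) _))).
rewrite -!filter_predI (eq_filter lt_ltS) (eq_filter ge_ltS) perm_cat //.
by rewrite perm_rev.
Qed.

Lemma pairwise_buckets (r q : rel T) L M : pairwise r L ->
  {in L &, forall u v, f u < f v -> q u v} ->
  {in L &, forall u v, f u = f v -> r v u -> q u v} ->
  pairwise q (buckets L M).
Proof.
move=> rL q_lt q_eq; elim: M => // M IH; rewrite bucketsS pairwise_cat IH /=.
apply/andP; split.
  apply/allrelP => u v; rewrite mem_buckets mem_bucket.
  move=> /andP[fu uL] /andP[/eqP fv vL].
  by apply: q_lt; rewrite ?fv.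
rewrite /bucket pairwise_rev.
have {}rL := pairwise_filter (fun v => f v == M) rL.
apply: (sub_in_pairwise (P := mem [seq v <- L | f v == M])) rL; last exact/allP.
move=> u v; rewrite !mem_filter => /andP[/eqP fu uL] /andP[/eqP fv vL].
by apply: q_eq => //; rewrite fu.
Qed.

End Buckets.

Definition pushed (f : nat -> nat) (L : seq nat) (h nx : nat -> nat) : Prop :=
  forall i, chain nx (h i) (bucket f L i).

Lemma pushed_rcons f L h nx v : v \notin L -> pushed f L h nx ->
  pushed f (rcons L v) (upd h (f v) v.+1) (upd nx v (h (f v))).
Proof.
move=> vL pL i; rewrite bucket_rcons [upd h _ _ i]/upd [i == _]eq_sym.
have vN : v \notin bucket f L i by rewrite mem_bucket (negPf vL) andbF.
have [fvi|_] := eqVneq (f v) i; last exact: chain_upd.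
by split=> //; rewrite [upd _ _ _ v]/upd eqxx fvi; exact: chain_upd.
Qed.

(** * The program *)

(* Nothing is written to [r_zero]; [r_cur_col] is 0 before the first vertex. *)
Local Notation r_vertices := 0 (only parsing).
Local Notation r_columns := 1 (only parsing).
Local Notation r_zero := 2 (only parsing).
Local Notation r_one := 3 (only parsing).
Local Notation r_relabel := 4 (only parsing).
Local Notation r_join := 5 (only parsing).
Local Notation r_prev_label := 6 (only parsing).
Local Notation r_cur_label := 7 (only parsing).
Local Notation r_count := 8 (only parsing).
Local Notation r_bucket := 9 (only parsing).
Local Notation r_pointer := 10 (only parsing).
Local Notation r_vertex := 11 (only parsing).
Local Notation r_key := 12 (only parsing).
Local Notation r_head := 13 (only parsing).
Local Notation r_prev_row := 14 (only parsing).
Local Notation r_prev_col := 15 (only parsing).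
Local Notation r_cur_row := 16 (only parsing).
Local Notation r_cur_col := 17 (only parsing).
Local Notation r_row := 18 (only parsing).
Local Notation r_col := 19 (only parsing).
Local Notation r_sign1 := 20 (only parsing).
Local Notation r_sign2 := 21 (only parsing).
Local Notation r_next_col := 22 (only parsing).
Local Notation r_last_col := 23 (only parsing).

Local Notation a_row := 0 (only parsing).
Local Notation a_col := 1 (only parsing).
Local Notation a_sign1 := 2 (only parsing).
Local Notation a_sign2 := 3 (only parsing).
Local Notation a_col_head := 5 (only parsing).
Local Notation a_col_next := 6 (only parsing).
Local Notation a_row_head := 7 (only parsing).
Local Notation a_row_next := 8 (only parsing).

Definition push_prog (H Nx : nat) : prog :=
  Get r_head H r_key ;; Put Nx r_vertex r_head ;;
  Add r_head r_vertex r_one ;; Put H r_key r_head.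

Lemma push_prog_wp W H Nx f vis s :
  H != Nx -> reg s r_vertex < W -> reg s r_one = 1 ->
  reg s r_vertex \notin vis -> reg s r_key = f (reg s r_vertex) ->
  pushed f vis (arr s H) (arr s Nx) ->
  wp W (push_prog H Nx) (fun s' =>
    [/\ pushed f (rcons vis (reg s r_vertex)) (arr s' H) (arr s' Nx),
        frame [:: r_head] [:: H; Nx] s s' & out s' = out s]) s.
Proof.
move=> HN vW one vN keyE /(pushed_rcons vN) p.
rewrite /= /upd /= one addn1 keyE !eqxx (negPf HN) eq_sym (negPf HN) /=.
do 5!split=> //; split=> x; rewrite !inE /=; first by move/negPf=> ->.
by rewrite negb_or => /andP[/negPf-> /negPf->].
Qed.

Definition next_bucket_prog (H : nat) : prog :=
  Get r_pointer H r_bucket ;; Add r_bucket r_bucket r_one.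

Definition visit_prog (Nx : nat) (body : prog) : prog :=
  Defs.Sub r_vertex r_pointer r_one ;; Get r_pointer Nx r_vertex ;;
  Add r_count r_count r_one ;; body.

Definition traverse_step (H Nx : nat) (body : prog) : prog :=
  If (Eq r_pointer r_zero) (next_bucket_prog H) (visit_prog Nx body).

(* Counting the visited vertices ends the loop without a test for the last
   bucket. *)
Definition traverse (H Nx : nat) (body : prog) : prog :=
  (Const r_count 0 ;; Const r_bucket 0 ;; Const r_pointer 0) ;;
  While (Lt r_count r_vertices) (traverse_step H Nx body).

Section Traverse.
Variables (W H Nx M : nat) (body : prog) (f : nat -> nat) (L : seq nat).
Variable Inv : seq nat -> state -> Prop.
Hypothesis key_bound : {in L, forall v, f v < M}.
Hypothesis M_fits : M <= W.
Hypothesis size_fits : size L <= W.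
Hypothesis Inv_data : forall vis s, Inv vis s ->
  [/\ reg s r_vertices = size L, reg s r_zero = 0, reg s r_one = 1
    & pushed f L (arr s H) (arr s Nx)].
Hypothesis Inv_emits : forall vis s s',
  emits [:: r_count; r_bucket; r_pointer; r_vertex] [::] s s' ->
  Inv vis s -> Inv vis s'.
Hypothesis Inv_body : forall vis v tl s, buckets f L M = vis ++ v :: tl ->
  Inv vis s -> reg s r_vertex = v ->
  wp W body (fun s' => [/\ Inv (rcons vis v) s', arr s' Nx = arr s Nx &
    {in [:: r_count; r_bucket; r_pointer], reg s' =1 reg s}]) s.

Lemma size_traversed : size (buckets f L M) = size L.
Proof. exact/perm_size/perm_buckets. Qed.

Definition later_buckets (i : nat) : seq nat :=
  flatten [seq bucket f L j | j <- iota i (M - i)].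

Definition traversing (s : state) : Prop :=
  exists vis rest,
    [/\ Inv vis s, chain (arr s Nx) (reg s r_pointer) rest,
        reg s r_count = size vis
      & buckets f L M = vis ++ rest ++ later_buckets (reg s r_bucket)].

Definition traverse_measure (s : state) : nat :=
  (size L - reg s r_count) + (M - reg s r_bucket).

Lemma next_bucket_prog_wp s : traversing s -> reg s r_count < size L ->
  reg s r_pointer = 0 ->
  wp W (next_bucket_prog H)
    (fun s' => traversing s' /\ traverse_measure s' < traverse_measure s) s.
Proof.
move=> [vis [rest [inv ch countE bucketsE]]] lt_count pointer0.
have [_ _ one pL] := Inv_data inv.
have rest0 : rest = [::].
  by case: rest ch {bucketsE} => //= v rest []; rewrite pointer0.
have lt_bucket : reg s r_bucket < M.
  rewrite ltnNge; apply/negP => le; have := congr1 size bucketsE.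
  rewrite size_traversed rest0 /later_buckets (eqP le) cats0 => sizeE.
  by rewrite sizeE countE ltnn in lt_count.
rewrite /= /upd /= one addn1.
do 2!split=> //; first exact: leq_trans lt_bucket M_fits.
split; last by rewrite /traverse_measure /= /upd /=; lia.
exists vis, (bucket f L (reg s r_bucket)); split=> //.
- by apply: Inv_emits inv; do 2!apply: emits_set_reg => //; exact: emits_refl.
- exact: pL.
- by rewrite bucketsE rest0 /later_buckets -(subnSK lt_bucket).
Qed.

Lemma visit_prog_wp s : traversing s -> reg s r_count < size L ->
  reg s r_pointer != 0 ->
  wp W (visit_prog Nx body)
    (fun s' => traversing s' /\ traverse_measure s' < traverse_measure s) s.
Proof.
move=> [vis [[|v rest] [inv ch countE bucketsE]]] lt_count.
  by rewrite [reg _ _]ch.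
move: ch => [pointerE ch] _; have [_ _ one pL] := Inv_data inv.
rewrite /= /upd /= one addn1 pointerE subn1 /=; do 3!split=> //.
  exact: leq_trans lt_count size_fits.
set s1 := set_reg _ _ _.
have I1 : Inv vis s1.
  by apply: Inv_emits inv; do 3!apply: emits_set_reg => //; exact: emits_refl.
apply: wp_mono (Inv_body bucketsE I1 (erefl _)) => s2 [I2 next_eq reg_eq].
split; last by rewrite /traverse_measure !reg_eq //= /upd /=; lia.
exists (rcons vis v), rest; rewrite next_eq !reg_eq //; split=> //.
- by rewrite size_rcons /= /upd /= countE.
- by rewrite cat_rcons.
Qed.

Lemma traverse_step_wp s : traversing s -> holds (Lt r_count r_vertices) s ->
  wp W (traverse_step H Nx body)
    (fun s' => traversing s' /\ traverse_measure s' < traverse_measure s) s.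
Proof.
move=> trav; have [vis [rest [inv _ _ _]]] := trav.
have [n0 zero _ _] := Inv_data inv; rewrite /holds n0 => lt_count.
apply: wp_if; rewrite /holds zero => pointer0; last exact: visit_prog_wp.
by apply: next_bucket_prog_wp => //; exact/eqP.
Qed.

Lemma traverse_loop_ends s : traversing s ->
  ends W (While (Lt r_count r_vertices) (traverse_step H Nx body)) s
    (traverse_measure s * (cost body + 5) + 1) (Inv (buckets f L M)).
Proof.
move=> trav; apply: ends_mono (ends_while traverse_step_wp trav).
  by rewrite /= leq_add2r leq_mul2l; apply/orP; right; lia.
move=> s' [[vis [rest [inv _ countE bucketsE]]]].
have [n0 _ _ _] := Inv_data inv.
rewrite /= n0 countE -leqNgt -size_traversed => vis_all.
suff -> : buckets f L M = vis by [].
have := congr1 (take (size vis)) bucketsE.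
by rewrite take_oversize // take_size_cat.
Qed.

Lemma traverse_ends s : Inv [::] s ->
  ends W (traverse H Nx body) s
    ((size L + M) * (cost body + 5) + 4) (Inv (buckets f L M)).
Proof.
move=> I0.
have start : wp W (Const r_count 0 ;; Const r_bucket 0 ;; Const r_pointer 0)
    (fun s' => traversing s' /\ traverse_measure s' = size L + M) s.
  do 3!split=> //; split; last by rewrite /traverse_measure /= /upd /= !subn0.
  exists [::], [::]; split=> //; last first.
    by rewrite /later_buckets /= /upd /= subn0.
  by apply: Inv_emits I0; do 3!apply: emits_set_reg => //; exact: emits_refl.
have loop s1 : traversing s1 /\ traverse_measure s1 = size L + M ->
    ends W (While (Lt r_count r_vertices) (traverse_step H Nx body)) s1
      ((size L + M) * (cost body + 5) + 1) (Inv (buckets f L M)).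
  by case=> trav <-; exact: traverse_loop_ends.
by apply: ends_mono (ends_seq (wp_ends start) loop) => //=; lia.
Qed.

End Traverse.

Definition emit (a b c : nat) : prog := Write a ;; Write b ;; Write c.

(* [Add] would need a bound on the result. *)
Definition copy (x y : nat) : prog := Defs.Sub x y r_zero.

Definition load_prog : prog :=
  Get r_row a_row r_vertex ;; Get r_col a_col r_vertex ;;
  Get r_sign1 a_sign1 r_vertex ;; Get r_sign2 a_sign2 r_vertex.

Definition add_vertex_prog : prog :=
  Write r_zero ;; Write r_zero ;; If (Eq r_cur_col r_zero) Skip (Write r_one).

Definition change_bubble_prog : prog :=
  emit r_relabel r_prev_label r_prev_col ;;
  emit r_relabel r_cur_label r_prev_label ;;
  copy r_prev_row r_cur_row ;; copy r_prev_col r_cur_col ;;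
  copy r_cur_row r_row ;; copy r_cur_col r_col.

Definition slide_prog : prog :=
  If (Eq r_row r_cur_row)
    (If (Eq r_col r_cur_col) Skip change_bubble_prog) change_bubble_prog.

Definition join_columns_prog : prog :=
  emit r_join r_zero r_col ;; Add r_next_col r_col r_one ;;
  If (Lt r_col r_columns) (emit r_join r_zero r_next_col) Skip ;;
  emit r_join r_zero r_cur_label.

Definition join_prev_prog : prog :=
  let join := emit r_join r_zero r_prev_label in
  Defs.Sub r_last_col r_col r_one ;;
  If (Eq r_prev_col r_col) join
    (If (Eq r_prev_col r_next_col) join
      (If (Eq r_prev_col r_last_col)
        (If (Eq r_prev_row r_row) (If (Eq r_sign1 r_one) join Skip) Skip)
        Skip)).

Definition joins_prog : prog := join_columns_prog ;; join_prev_prog.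

Definition relabel_prog : prog :=
  If (Eq r_sign2 r_one) (emit r_relabel r_zero r_cur_label)
    (emit r_relabel r_zero r_col).

Definition place_prog : prog :=
  load_prog ;; add_vertex_prog ;; slide_prog ;;
  joins_prog ;; relabel_prog.

Definition setup_prog : prog :=
  Const r_one 1 ;; Const r_relabel 2 ;; Const r_join 3 ;;
  Add r_prev_label r_columns r_one ;; Add r_cur_label r_prev_label r_one.

Definition column_prog : prog :=
  Get r_key a_col r_vertex ;; Defs.Sub r_key r_columns r_key ;;
  push_prog a_col_head a_col_next ;; Add r_vertex r_vertex r_one.

Definition row_prog : prog :=
  Get r_key a_row r_vertex ;; push_prog a_row_head a_row_next.

Definition expression_prog : prog :=
  setup_prog ;; While (Lt r_vertex r_vertices) column_prog ;;
  traverse a_col_head a_col_next row_prog ;;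
  traverse a_row_head a_row_next place_prog.

Definition opt_code (o : option cwterm) : seq nat := oapp code [::] o.

Definition slide_code (k : nat) (w : window) (p : place) : seq nat :=
  if key p == cur_bubble w then [::]
  else [:: 2; k.+1; (prev_bubble w).2; 2; k.+2; k.+1].

Lemma code_extend_term k occupied o w p :
  code (extend_term k occupied o w p) =
  opt_code o ++ (if isSome o then [:: 0; 0; 1] else [:: 0; 0]) ++
  slide_code k w p ++
  flatten [seq [:: 3; 0; j] | j <- neighbour_labels k occupied (slide w p) p] ++
  [:: 2; 0; place_label k (slide w p) p].
Proof.
rewrite [LHS]/= code_join_all /slide_term /slide_code.
by case: o => [t|]; case: ifP => _ /=; rewrite -?catA.
Qed.

(** * Correctness and running time of the program *)

Section Program.
Variables (k : nat) (l : seq place).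
Let n : nat := size l.
Hypothesis columns_le : k <= n.
Hypothesis col_bound : {in l, forall p, 0 < pcol p <= k}.
Hypothesis row_bound : {in l, forall p, prow p <= n}.

Definition place_at (v : nat) : place := nth (Place 0 0 false false) l v.

Lemma place_at_col v : v < n -> 0 < pcol (place_at v) <= k.
Proof. by move=> vn; apply: col_bound; rewrite mem_nth. Qed.

Lemma place_at_row v : v < n -> prow (place_at v) <= n.
Proof. by move=> vn; apply: row_bound; rewrite mem_nth. Qed.

(* From right to left: pushing the vertices on their rows reverses the order. *)
Definition column_key (v : nat) : nat := k - pcol (place_at v).
Definition row_key (v : nat) : nat := prow (place_at v).
Definition by_column : seq nat := buckets column_key (iota 0 n) n.+1.
Definition by_row : seq nat := buckets row_key by_column n.+1.

Definition places_by_row : seq place := [seq place_at v | v <- by_row].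

Lemma column_key_bound : {in iota 0 n, forall v, column_key v < n.+1}.
Proof. by move=> v _; rewrite ltnS (leq_trans (leq_subr _ _)). Qed.

Lemma perm_by_column : perm_eq by_column (iota 0 n).
Proof. exact/perm_buckets/column_key_bound. Qed.

Lemma mem_by_column v : (v \in by_column) = (v < n).
Proof. by rewrite (perm_mem perm_by_column) mem_iota. Qed.

Lemma row_key_bound : {in by_column, forall v, row_key v < n.+1}.
Proof. by move=> v; rewrite mem_by_column ltnS => /place_at_row. Qed.

Lemma perm_by_row : perm_eq by_row (iota 0 n).
Proof. exact: perm_trans (perm_buckets row_key_bound) perm_by_column. Qed.

Lemma mem_by_row v : (v \in by_row) = (v < n).
Proof. by rewrite (perm_mem perm_by_row) mem_iota. Qed.

Lemma sorted_places_by_row : sorted <=%O [seq key p | p <- places_by_row].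
Proof.
rewrite sorted_pairwise; last exact: le_trans.
rewrite !pairwise_map.
apply: (@pairwise_buckets _ _ (fun u v => column_key u <= column_key v)).
- apply: (@pairwise_buckets _ _ (fun _ _ => true)).
  + exact/(pairwiseP 0).
  + by move=> u v _ _ /ltnW.
  + by move=> u v _ _ ->.
- by move=> u v _ _; rewrite /row_key /= leEprodlexi /=; lia.
- move=> u v; rewrite !mem_by_column => /place_at_col cu /place_at_col cv.
  by rewrite /row_key /column_key /= leEprodlexi /=; lia.
Qed.

Lemma perm_places_by_row : perm_eq places_by_row l.
Proof.
apply/(perm_iotaP (Place 0 0 false false)).
by exists by_row; rewrite ?perm_by_row.
Qed.

Variable W : nat.
Hypothesis size_fits : n + 3 <= W.

Definition model_column (j : nat) : bool := 0 < j <= k.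

Definition input_arrays (s : state) : Prop :=
  [/\ forall v, v < n -> arr s a_row v = prow (place_at v),
      forall v, v < n -> arr s a_col v = pcol (place_at v),
      forall v, v < n -> arr s a_sign1 v = psign1 (place_at v)
    & forall v, v < n -> arr s a_sign2 v = psign2 (place_at v)].

Definition constants (s : state) : Prop :=
  [/\ [/\ reg s r_vertices = n, reg s r_columns = k & reg s r_zero = 0],
      [/\ reg s r_one = 1, reg s r_relabel = 2 & reg s r_join = 3],
      reg s r_prev_label = k.+1 & reg s r_cur_label = k.+2].

Definition ready (s : state) : Prop := constants s /\ input_arrays s.

Lemma frame_ready R A s s' : frame R A s s' ->
  all [predC R] (iota r_vertices 8) -> all [predC A] (iota a_row 4) ->
  ready s -> ready s'.
Proof.
move=> f /(frame_reg f) regE /(frame_arr f) arrE.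
by rewrite /ready /constants /input_arrays !regE // !arrE.
Qed.

Definition tracks (w : window) (s : state) : Prop :=
  prev_bubble w = (reg s r_prev_row, reg s r_prev_col) /\
  cur_bubble w = (reg s r_cur_row, reg s r_cur_col).

Definition loaded (p : place) (s : state) : Prop :=
  [/\ reg s r_row = prow p, reg s r_col = pcol p, reg s r_sign1 = psign1 p
    & reg s r_sign2 = psign2 p].

Definition window_regs : seq nat :=
  [:: r_prev_row; r_prev_col; r_cur_row; r_cur_col].

Definition place_regs : seq nat := [:: r_row; r_col; r_sign1; r_sign2].

Lemma frame_tracks R A w s s' : frame R A s s' ->
  all [predC R] window_regs -> tracks w s -> tracks w s'.
Proof. by move=> f /(frame_reg f) regE; rewrite /tracks !regE. Qed.

Lemma frame_loaded R A p s s' : frame R A s s' ->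
  all [predC R] place_regs -> loaded p s -> loaded p s'.
Proof. by move=> f /(frame_reg f) regE; rewrite /loaded !regE. Qed.

Definition scene (w : window) (p : place) (s : state) : Prop :=
  [/\ ready s, tracks w s & loaded p s].

Lemma emits_scene R o w p s s' : emits R o s s' ->
  all (leq r_next_col) R -> scene w p s -> scene w p s'.
Proof.
move=> [f _] /allP R22 [rdy trk ld].
have kept xs : all (gtn r_next_col) xs -> all [predC R] xs.
  move=> /allP xs22; apply/allP => x /xs22 /=; rewrite ltnNge.
  by apply: contra => /R22.
split.
- by apply: frame_ready f _ _ rdy; rewrite ?kept.
- by apply: frame_tracks f _ trk; rewrite kept.
- by apply: frame_loaded f _ ld; rewrite kept.
Qed.

Ltac discharge_fits := do ?[split; first exact: isT].

Ltac solve_emits :=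
  split; [ split=> // ?; rewrite !inE /= /upd; do ?case: eqP => //
         | by rewrite /= -?cats1 -?catA ?cats0 ].

Lemma load_prog_wp s w v : ready s -> tracks w s ->
  reg s r_vertex = v -> v < n ->
  wp W load_prog
    (fun s' => emits place_regs [::] s s' /\ scene w (place_at v) s') s.
Proof.
move=> rdy trk vE vn; have [_ [rowE colE sign1E sign2E]] := rdy.
rewrite /= /upd /= vE rowE // colE // sign1E // sign2E //.
do 4!split=> //; set s' := set_reg _ _ _.
have e : emits place_regs [::] s s'.
  by do 4!apply: emits_set_reg => //; exact: emits_refl.
by split.
Qed.

Lemma add_vertex_prog_wp s : ready s ->
  wp W add_vertex_prog
    (emits [::] (if reg s r_cur_col == 0 then [:: 0; 0] else [:: 0; 0; 1]) s) s.
Proof.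
move=> [[[_ _ zero] [one _ _] _ _] _]; rewrite /= zero one.
by case: (_ == 0); discharge_fits; solve_emits.
Qed.

Lemma change_bubble_prog_wp s w p : scene w p s ->
  wp W change_bubble_prog (fun s' =>
    emits window_regs [:: 2; k.+1; (prev_bubble w).2; 2; k.+2; k.+1] s s' /\
    scene (Window (cur_bubble w) (key p)) p s') s.
Proof.
case: w => b c [rdy [/= -> ->] ld].
have [[[_ _ zero] [one relabel _] prev_label cur_label] _] := rdy.
have [rowE colE _ _] := ld.
rewrite /= /upd /= rowE colE zero relabel prev_label cur_label !subn0.
do 10!split=> //; set s' := set_reg _ _ _.
have e : emits window_regs [:: 2; k.+1; reg s r_prev_col; 2; k.+2; k.+1] s s'.
  by do 4!apply: emits_set_reg => //; split=> //=; rewrite -!cats1 -!catA.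
by split.
Qed.

Lemma slide_prog_wp s w p : scene w p s ->
  wp W slide_prog (fun s' =>
    emits window_regs (slide_code k w p) s s' /\ scene (slide w p) p s') s.
Proof.
move=> sc; have change := change_bubble_prog_wp sc.
have same_bubble : (key p == cur_bubble w) =
    (reg s r_row == reg s r_cur_row) && (reg s r_col == reg s r_cur_col).
  by have [_ [_ ->] [-> -> _ _]] := sc.
rewrite /slide_prog /slide /slide_code same_bubble.
apply: wp_if; rewrite /holds; [move=> -> | by move=> /negPf->].
apply: wp_if; rewrite /holds; [move=> -> | by move=> /negPf->].
by split=> //; exact: emits_refl.
Qed.

Lemma join_columns_prog_wp s w p : scene w p s -> pcol p <= k ->
  wp W join_columns_prog (fun s' =>
    emits [:: r_next_col] ([:: 3; 0; pcol p] ++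
      (if pcol p < k then [:: 3; 0; (pcol p).+1] else [::]) ++
      [:: 3; 0; k.+2]) s s' /\
    reg s' r_next_col = (pcol p).+1) s.
Proof.
move=> [[[[_ columns zero] [one _ join] _ cur_label] _] _ [_ colE _ _]] pk.
rewrite /= /upd /= columns zero one join cur_label colE addn1.
have -> : pcol p < W by lia.
by case: (_ < k); discharge_fits; split=> //; solve_emits.
Qed.

Lemma join_prev_prog_wp s w p :
  scene w p s -> 0 < pcol p -> reg s r_next_col = (pcol p).+1 ->
  wp W join_prev_prog (emits [:: r_last_col]
    (if meets (prev_bubble w) p then [:: 3; 0; k.+1] else [::]) s) s.
Proof.
case: w => b c [[[[_ _ zero] [one _ join] prev_label _] _] [/= -> _]].
move=> [rowE colE sign1E _] p0 next_col; rewrite /meets /=.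
have last_colE :
    (reg s r_prev_col == pcol p - 1) = ((reg s r_prev_col).+1 == pcol p) by lia.
rewrite /upd /= zero one join prev_label rowE colE sign1E next_col last_colE.
case: (_ == pcol p) => /=; first by discharge_fits; solve_emits.
case: (_ == (pcol p).+1) => /=; first by discharge_fits; solve_emits.
by case: (_ == pcol p); case: (_ == prow p); case: (psign1 p) => /=;
  discharge_fits; solve_emits.
Qed.

Lemma joins_prog_wp s w p : scene w p s -> 0 < pcol p <= k ->
  wp W joins_prog (emits [:: r_next_col; r_last_col]
    (flatten [seq [:: 3; 0; j] | j <- neighbour_labels k model_column w p])
    s) s.
Proof.
move=> sc /andP[p0 pk].
apply: wp_seq (join_columns_prog_wp sc pk) _ => s1 [e1 next_col].
apply: wp_mono (join_prev_prog_wp (emits_scene e1 isT sc) p0 next_col) => s2.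
move/(emits_trans e1); rewrite /neighbour_labels /model_column /=.
by case: (_ < k); case: (meets _ _).
Qed.

Lemma relabel_prog_wp s w p : scene w p s -> cur_bubble w = key p ->
  wp W relabel_prog (emits [::] [:: 2; 0; place_label k w p] s) s.
Proof.
move=> [[[[_ _ zero] [one relabel _] _ cur_label] _] _ [_ colE _ sign2E]].
rewrite /place_label => ->; rewrite eqxx andbT /= zero one relabel cur_label.
rewrite colE sign2E.
by case: (psign2 p); discharge_fits; solve_emits.
Qed.

Lemma place_prog_wp s v o w : v < n -> ready s -> tracks w s ->
  reg s r_vertex = v -> (reg s r_cur_col == 0) = ~~ isSome o ->
  out s = opt_code o ->
  wp W place_prog (fun s' =>
    [/\ frame (iota r_prev_row 10) [::] s s', tracks (slide w (place_at v)) s'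
      & out s' = code (extend_term k model_column o w (place_at v))]) s.
Proof.
move=> vn rdy trk vE first_vertex out_s; rewrite /place_prog.
apply: wp_seq (load_prog_wp rdy trk vE vn) _ => s1 [e1 sc1].
have {}first_vertex : (reg s1 r_cur_col == 0) = ~~ isSome o.
  by rewrite (proj1 (proj1 e1)).
have [rdy1 _ _] := sc1.
apply: wp_seq (add_vertex_prog_wp rdy1) _ => s2 e2.
have sc2 := emits_scene e2 isT sc1.
apply: wp_seq (slide_prog_wp sc2) _ => s3 [e3 sc3].
apply: wp_seq (joins_prog_wp sc3 (place_at_col vn)) _ => s4 e4.
have sc4 := emits_scene e4 isT sc3.
apply: wp_mono (relabel_prog_wp sc4 (cur_bubble_slide w _)) => s5 e5.
have [_ trk5 _] := emits_scene e5 isT sc4.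
have [frame5 out5] :=
  emits_trans e1 (emits_trans e2 (emits_trans e3 (emits_trans e4 e5))).
split=> //; first by apply: frameS frame5; apply/allP.
by rewrite out5 out_s first_vertex code_extend_term; case: (o).
Qed.

Definition sorting (cols rows : seq nat) (s : state) : Prop :=
  [/\ ready s, pushed column_key cols (arr s a_col_head) (arr s a_col_next),
      pushed row_key rows (arr s a_row_head) (arr s a_row_next),
      tracks (Window (0, 0) (0, 0)) s & out s = [::]].

Definition printing (vis : seq nat) (s : state) : Prop :=
  let st := build k model_column [seq place_at v | v <- vis] in
  [/\ ready s, pushed row_key by_column (arr s a_row_head) (arr s a_row_next),
      tracks st.2 s, (reg s r_cur_col == 0) = ~~ isSome st.1
    & out s = opt_code st.1].

Lemma column_prog_wp s : sorting (iota 0 (reg s r_vertex)) [::] s ->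
  reg s r_vertex < n ->
  wp W column_prog (fun s' => sorting (iota 0 (reg s' r_vertex)) [::] s' /\
                              reg s' r_vertex = (reg s r_vertex).+1) s.
Proof.
move=> [rdy pc pr trk out0] vn.
have [[[_ columns _] [one _ _] _ _] [_ colE _ _]] := rdy.
do 2!split=> //; set s1 := effect _ _.
have f1 : frame [:: r_key] [::] s s1 by do 2!apply: frame_set_reg => //.
have key1 : reg s1 r_key = column_key (reg s r_vertex).
  by rewrite /= /upd /= columns colE.
apply: wp_seq (push_prog_wp _ _ _ _ key1 pc) _ => //.
- by apply: leq_trans vn _; lia.
- by rewrite mem_iota ltnn.
move=> s2 [p2 f2 out2]; have f12 := frame_trans f1 f2.
have vertex2 : reg s2 r_vertex = reg s r_vertex by apply: (proj1 f12).
have one2 : reg s2 r_one = 1 by rewrite (proj1 f12).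
rewrite /= vertex2 one2 addn1; split; first by lia.
set s3 := set_reg _ _ _.
have f13 : frame [:: r_vertex; r_key; r_head] [:: a_col_head; a_col_next] s s3.
  by apply: frame_set_reg => //; apply: frameS f12 => //; exact/allP.
split=> //; split.
- exact: frame_ready f13 isT isT rdy.
- by rewrite /upd eqxx -(addn1 (reg s _)) iotaD cats1.
- by rewrite !(proj2 f13).
- exact: frame_tracks f13 isT trk.
- by rewrite /= out2.
Qed.

Lemma row_prog_wp s vis v : v < n -> v \notin vis ->
  sorting (iota 0 n) vis s -> reg s r_vertex = v ->
  wp W row_prog (fun s' => [/\ sorting (iota 0 n) (rcons vis v) s',
    arr s' a_col_next = arr s a_col_next &
    {in [:: r_count; r_bucket; r_pointer], reg s' =1 reg s}]) s.
Proof.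
move=> vn vvis [rdy pc pr trk out0] vE.
have [[_ [one _ _] _ _] [rowE _ _ _]] := rdy.
split=> //; set s1 := effect _ _.
have f1 : frame [:: r_key] [::] s s1 by apply: frame_set_reg.
have key1 : reg s1 r_key = row_key (reg s1 r_vertex).
  by rewrite /= /upd /= vE rowE.
have vertex_fits : reg s1 r_vertex < W.
  by rewrite [reg _ _]vE; apply: leq_trans vn _; lia.
have fresh : reg s1 r_vertex \notin vis by rewrite [reg _ _]vE.
apply: wp_mono (push_prog_wp _ vertex_fits one fresh key1 pr) => //.
move=> s2 [p2 f2 out2]; have f12 := frame_trans f1 f2; split.
- split.
  + exact: frame_ready f12 isT isT rdy.
  + by rewrite !(proj2 f12).
  + by move: p2; rewrite [reg s1 _]vE.
  + exact: frame_tracks f12 isT trk.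
  + by rewrite out2.
- exact: (proj2 f12).
- by apply: frame_reg f12 _.
Qed.

Lemma print_prog_wp s vis v : v < n ->
  printing vis s -> reg s r_vertex = v ->
  wp W place_prog (fun s' => [/\ printing (rcons vis v) s',
    arr s' a_row_next = arr s a_row_next &
    {in [:: r_count; r_bucket; r_pointer], reg s' =1 reg s}]) s.
Proof.
move=> vn [rdy pr trk first_vertex out_s] vE.
have := place_prog_wp vn rdy trk vE first_vertex out_s.
apply: wp_mono => s' [f trk' out'].
split; first last.
- by apply: frame_reg f _.
- exact: (proj2 f).
rewrite /printing map_rcons /build foldl_rcons -/(build _ _ _); split=> //.
- exact: frame_ready f isT isT rdy.
- by rewrite !(proj2 f).
- have [_] := trk'; rewrite cur_bubble_slide => -[_ <-].
  by have := place_at_col vn; case: (pcol _).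
Qed.

Definition initial (s : state) : Prop :=
  [/\ reg s r_vertices = n /\ reg s r_columns = k,
      forall x, r_columns < x -> reg s x = 0, input_arrays s,
      forall a, 4 < a -> arr s a = (fun=> 0) & out s = [::]].

Lemma setup_prog_wp s : initial s ->
  wp W setup_prog
    (fun s' => sorting [::] [::] s' /\ reg s' r_vertex = 0) s.
Proof.
move=> [[vertices columns] regs0 arrs arrs0 out0].
rewrite /= /upd /= columns !addn1; do 5!(split; first by lia).
split; last by rewrite /= regs0.
split=> //.
- by do 3!split=> //; rewrite /= /upd /= regs0.
- by move=> i; rewrite /= arrs0.
- by move=> i; rewrite /= arrs0.
- by split; rewrite /= /upd /= !regs0.
Qed.

Lemma column_loop_ends s : sorting [::] [::] s -> reg s r_vertex = 0 ->
  ends W (While (Lt r_vertex r_vertices) column_prog) s (n * 8 + 1)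
    (sorting (iota 0 n) [::]).
Proof.
move=> sort0 vertex0.
pose inv s := sorting (iota 0 (reg s r_vertex)) [::] s /\ reg s r_vertex <= n.
have body s1 : inv s1 -> holds (Lt r_vertex r_vertices) s1 ->
    wp W column_prog
      (fun s' => inv s' /\ n - reg s' r_vertex < n - reg s1 r_vertex) s1.
  move=> [sort1 _]; have [[[[vertices _ _] _ _ _] _] _ _ _ _] := sort1.
  rewrite /holds vertices => vn.
  apply: wp_mono (column_prog_wp sort1 vn) => s2 [sort2 vertex2].
  by split; [split=> //; rewrite vertex2 | rewrite vertex2; lia].
have inv0 : inv s by rewrite /inv vertex0.
apply: ends_mono (ends_while body inv0); first by rewrite vertex0 subn0.
move=> s' [[sort' vertex_le]].
have [[[[vertices _ _] _ _ _] _] _ _ _ _] := sort'.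
rewrite /holds vertices -leqNgt => vertex_ge.
by have -> : n = reg s' r_vertex by lia.
Qed.

Lemma row_loop_ends s : sorting (iota 0 n) [::] s ->
  ends W (traverse a_col_head a_col_next row_prog) s ((n + n.+1) * 10 + 4)
    (sorting (iota 0 n) by_column).
Proof.
move=> sort0; rewrite -[X in (X + _) * _](size_iota 0 n).
apply: (traverse_ends column_key_bound) sort0.
- by lia.
- by rewrite size_iota; lia.
- by move=> vis s1 [[[[-> _ ->] [-> _ _] _ _] _] pc _ _ _]; rewrite size_iota.
- move=> vis s1 s2 [f e] [rdy pc pr trk out0]; split.
  + exact: frame_ready f isT isT rdy.
  + by rewrite !(proj2 f).
  + by rewrite !(proj2 f).
  + exact: frame_tracks f isT trk.
  + by rewrite e out0.
move=> vis v tl s1 bucketsE; apply: row_prog_wp.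
  by rewrite -mem_by_column /by_column bucketsE mem_cat mem_head orbT.
have := iota_uniq 0 n; rewrite -(perm_uniq perm_by_column) /by_column bucketsE.
by rewrite cat_uniq /= => /and3P[_ /norP[]].
Qed.

Lemma print_loop_ends s : printing [::] s ->
  ends W (traverse a_row_head a_row_next place_prog) s
    ((n + n.+1) * (cost place_prog + 5) + 4) (printing by_row).
Proof.
move=> print0; have size_by_column : size by_column = n.
  by rewrite (perm_size perm_by_column) size_iota.
rewrite -[X in (X + _) * _]size_by_column.
apply: (traverse_ends row_key_bound) print0.
- by lia.
- by rewrite size_by_column; lia.
- move=> vis s1 [[[[-> _ ->] [-> _ _] _ _] _] pr _ _ _].
  by rewrite size_by_column.
- move=> vis s1 s2 [f e] [rdy pr trk first_vertex out1]; split.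
  + exact: frame_ready f isT isT rdy.
  + by rewrite !(proj2 f).
  + exact: frame_tracks f isT trk.
  + by rewrite (proj1 f).
  + by rewrite e out1 cats0.
move=> vis v tl s1 bucketsE; apply: print_prog_wp.
by rewrite -mem_by_row /by_row bucketsE mem_cat mem_head orbT.
Qed.

Lemma expression_prog_ends s : initial s ->
  ends W expression_prog s (200 * n + 100) (fun s' =>
    out s' = opt_code (build k model_column places_by_row).1).
Proof.
move=> init_s.
have columns s1 : sorting [::] [::] s1 /\ reg s1 r_vertex = 0 ->
    ends W (While (Lt r_vertex r_vertices) column_prog) s1 (n * 8 + 1)
      (sorting (iota 0 n) [::]).
  by case; exact: column_loop_ends.
have print s1 : sorting (iota 0 n) by_column s1 ->
    ends W (traverse a_row_head a_row_next place_prog) s1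
      ((n + n.+1) * (cost place_prog + 5) + 4) (printing by_row).
  move=> [rdy _ pr trk out0]; apply: print_loop_ends; split=> //.
  by have [_ [_ <-]] := trk.
apply: ends_mono (ends_seq (wp_ends (setup_prog_wp init_s)) (fun s1 set_up =>
  ends_seq (columns s1 set_up) (fun s2 by_col =>
  ends_seq (row_loop_ends by_col) print))).
  by rewrite /=; lia.
by move=> s' [].
Qed.

End Program.

(** * Bubble models *)

Lemma leq_card_onto (A : finType) (f : A -> nat) m :
  (forall i, 0 < i <= m -> exists x, f x = i) -> m <= #|A|.
Proof.
move=> onto; rewrite -(size_iota 1 m) cardE -(size_map f).
apply: uniq_leq_size (iota_uniq 1 m) _ => i; rewrite mem_iota add1n ltnS.
by move=> /onto[x <-]; rewrite map_f ?mem_enum.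
Qed.

Section BubbleStructure.
Variables (A : finType) (B : bubble_structure A) (w : A -> place).
Hypothesis wP : forall x, x \in quadrant B (prow (w x)) (pcol (w x))
                                          (psign1 (w x)) (psign2 (w x)).

Lemma in_quadrant x i j s t : (x \in quadrant B i j s t) =
  [&& i == prow (w x), j == pcol (w x), s == psign1 (w x) & t == psign2 (w x)].
Proof.
apply/idP/and4P => [xq|[/eqP-> /eqP-> /eqP-> /eqP->]]; last exact: wP.
by have [-> -> -> ->] := quadrant_disjoint xq (wP x).
Qed.

Lemma in_bubble x i j :
  (x \in bubble B i j) = (i == prow (w x)) && (j == pcol (w x)).
Proof.
rewrite /bubble !inE !in_quadrant.
by case: (i == _); case: (j == _); case: (psign1 _); case: (psign2 _).
Qed.

Lemma in_bubble_xp x i j : (x \in bubble_xp B i j) =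
  [&& i == prow (w x), j == pcol (w x) & psign2 (w x)].
Proof.
rewrite /bubble_xp !inE !in_quadrant.
by case: (i == _); case: (j == _); case: (psign1 _); case: (psign2 _).
Qed.

Lemma in_bubble_px x i j : (x \in bubble_px B i j) =
  [&& i == prow (w x), j == pcol (w x) & psign1 (w x)].
Proof.
rewrite /bubble_px !inE !in_quadrant.
by case: (i == _); case: (j == _); case: (psign1 _); case: (psign2 _).
Qed.

Lemma bubble_adj_orderedP u v : bubble_adj_ordered B u v <->
  (pcol (w u) == pcol (w v)) || place_next (w u) (w v).
Proof.
split.
- move=> [i [j [i' [j' []]]]]; rewrite !in_bubble.
  move=> /andP[/eqP-> /eqP->] /andP[/eqP-> /eqP->].
  rewrite in_bubble_xp in_bubble_px /place_next.
  by case=> [->|[<- ->]|[<- -> /and3P[_ _ ->] /and3P[_ _ ->]]];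
    rewrite !eqxx ?orbT.
- move=> adj; exists (prow (w u)), (pcol (w u)), (prow (w v)), (pcol (w v)).
  rewrite !in_bubble in_bubble_xp in_bubble_px !eqxx /=; split=> //.
  case/orP: adj => [/eqP|]; first by constructor 1.
  move=> /andP[/eqP <-] /orP[lt|/and3P[/eqP-> -> ->]]; first by constructor 2.
  by constructor 3.
Qed.

Lemma bubble_adjP u v : bubble_adj B u v <-> u <> v /\ place_adj (w u) (w v).
Proof.
have adjE : place_adj (w u) (w v) =
    ((pcol (w u) == pcol (w v)) || place_next (w u) (w v)) ||
    ((pcol (w v) == pcol (w u)) || place_next (w v) (w u)).
  by rewrite /place_adj [pcol (w v) == _]eq_sym; case: (pcol _ == _).
rewrite /bubble_adj adjE; split=> -[uv adj]; split=> //.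
  by case: adj => /bubble_adj_orderedP ->; rewrite ?orbT.
by case/orP: adj => /bubble_adj_orderedP; [left | right].
Qed.

Lemma bubble_placement (G : sgraph) (f : G -> A) : injective f ->
  (forall x y, sedge x y <-> bubble_adj B (f x) (f y)) -> placement (w \o f).
Proof.
move=> f_inj fE x y; apply/idP/andP => [/fE/bubble_adjP[fxy adj]|[/eqP xy adj]].
  by split=> //; apply/eqP => xy; apply: fxy; rewrite xy.
by apply/fE/bubble_adjP; split=> // /f_inj.
Qed.

Lemma place_index x :
  (0 < pcol (w x) <= ncols B) && (0 < prow (w x) <= nrows B (pcol (w x))).
Proof. exact: quadrant_index (wP x). Qed.

Lemma row_leq_card x :
  (forall i j, 1 <= j <= ncols B -> 1 <= i <= nrows B j ->
     exists j', bubble B i j' != set0) -> prow (w x) <= #|A|.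
Proof.
move=> rows; have /andP[cx rx] := place_index x.
apply: (@leq_card_onto _ (prow \o w)) => i i_bound.
have [|j' /set0Pn[y]] := rows i _ cx; first by lia.
by rewrite in_bubble => /andP[/eqP-> _]; exists y.
Qed.

Lemma column_occupied j :
  (exists i, bubble B i j != set0) -> exists x, pcol (w x) = j.
Proof.
by move=> [i /set0Pn[x]]; rewrite in_bubble => /andP[_ /eqP->]; exists x.
Qed.

End BubbleStructure.

Lemma initial_init (A : finType) (B : bubble_structure A) (l : seq place) :
  initial (ncols B) l (init B l).
Proof.
split=> //.
- by case=> [|[|x]] //= _; rewrite nth_nil.
- by split=> v vn; rewrite /= (nth_map (Place 0 0 false false)).
- by do 5![case=> //]; move=> a _; rewrite /= nth_nil.
Qed.

Lemma perm_listing_placement (G : sgraph) (f : G -> G) (w : G -> place) e :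
  bijective f -> perm_eq e (enum G) ->
  perm_eq (map w e) (map (w \o f) (enum G)).
Proof.
move=> [g fK gK] eG; rewrite map_comp; apply/perm_map/(perm_trans eG).
apply: uniq_perm; rewrite ?enum_uniq ?(map_inj_uniq (can_inj fK)) ?enum_uniq //.
move=> x; rewrite mem_enum; apply/esym/mapP.
by exists (g x); rewrite ?mem_enum.
Qed.

Lemma bubble_expression_prog (G : sgraph) (B : bubble_structure G)
    (l : seq place) : bubble_model B -> listing B l ->
  exists (t : cwterm) (T : nat) (s : state),
    [/\ run (300 * #|G|) expression_prog (init B l) T s, T <= 300 * #|G|,
        out s = code t, k_expression (2 * alpha G + 3) t & defines t G].
Proof.
move=> [[f [f_bij fE]] [colsB rowsB _ _ _]] [e [w [eG wP lE]]].
have G0 := bubble_carrier B.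
have size_l : size l = #|G| by rewrite lE size_map (perm_size eG) -cardE.
have occupied j : 0 < j <= ncols B -> exists x, pcol (w x) = j.
  by move=> /colsB; exact: column_occupied.
have columns_le : ncols B <= size l.
  by rewrite size_l; exact: leq_card_onto occupied.
have col_bound : {in l, forall p, 0 < pcol p <= ncols B}.
  by move=> p; rewrite lE => /mapP[x _ ->]; have /andP[] := place_index wP x.
have row_bound : {in l, forall p, prow p <= size l}.
  move=> p; rewrite {1}lE size_l => /mapP[x _ ->]; exact: row_leq_card rowsB.
have size_fits : size l + 3 <= 300 * #|G| by lia.
have [T [s [s_run T_le out_s]]] := expression_prog_ends
  columns_le col_bound row_bound size_fits (initial_init B l).
have [|||t [tE t_expr t_def]] := build_k_expression
  (k := ncols B) (occupied := model_column (ncols B))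
  (bubble_placement wP (bij_inj f_bij) fE) G0 _ _ _
  (sorted_places_by_row columns_le col_bound).
- by [].
- move=> j; split=> [/occupied[x <-]|[x <-]].
    by have [g fK gK] := f_bij; exists (g x); rewrite /= gK.
  by have /andP[] := place_index wP (f x).
- apply: perm_trans (perm_places_by_row columns_le row_bound) _.
  by rewrite lE; exact: perm_listing_placement.
exists t, T, s; split=> //; first by lia.
by rewrite out_s tE.
Qed.

(** * Unit intervals *)

Lemma unit_intervals_meet (R : realType) (a b : R) (al ar bl br : bool) :
  (a <= b)%R ->
  (exists z, (z \in Interval (BSide al a) (BSide ar (a + 1)%R)) &&
             (z \in Interval (BSide bl b) (BSide br (b + 1)%R))) <->
  (b < a + 1)%R \/ b = (a + 1)%R /\ ~~ ar /\ bl.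
Proof.
move=> ab; split.
- move=> [z]; rewrite !in_itv /= => /andP[/andP[_ za] /andP[zb _]].
  by case: ar bl za zb => [] [] /= za zb; lra.
- case=> [lt|[-> [/negbTE -> ->]]].
    exists ((b + a + 1) / 2)%R; rewrite !in_itv /=.
    by case: al ar bl br => [] [] [] [] /=; lra.
  exists (a + 1)%R; rewrite !in_itv /= lexx.
  by case: al br => [] [] /=; lra.
Qed.

Section Rank.
Variables (d : Order.disp_t) (T : orderType d) (A : finType) (f : A -> T).

Definition rank (x : A) : nat := #|[set y | (f y < f x)%O]|.

Lemma ltn_rank x y : (rank x < rank y) = (f x < f y)%O.
Proof.
have mono u v : (f u <= f v)%O -> rank u <= rank v.
  move=> uv; apply/subset_leq_card/fintype.subsetP => z; rewrite !inE => zu.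
  exact: lt_le_trans zu uv.
have [xy|/mono] := ltP (f x) (f y); last by rewrite ltnNge => ->.
apply/proper_card/properP; split; last by exists x; rewrite !inE ?ltxx.
by apply/fintype.subsetP => z; rewrite !inE => zu; exact: lt_trans zu xy.
Qed.

Lemma eq_rank x y : (rank x == rank y) = (f x == f y).
Proof.
by rewrite eqn_leq eq_le (leqNgt (rank x)) (leqNgt (rank y)) !ltn_rank -!leNgt.
Qed.

End Rank.

Section UnitIntervals.
Variables (R : realType) (G : sgraph) (a : G -> R) (cl cr : G -> bool).
Hypothesis edgeE : forall x y : G, sedge x y <-> x <> y /\ exists z : R,
  (z \in Interval (BSide (cl x) (a x)) (BSide (cr x) (a x + 1)%R)) &&
  (z \in Interval (BSide (cl y) (a y)) (BSide (cr y) (a y + 1)%R)).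

Definition frac (x : G) : R := (a x - (Num.floor (a x))%:~R)%R.

(* Added to the integral parts to make them natural numbers. *)
Definition shift : nat := \sum_x `|Num.floor (a x)|%N.

Definition column (x : G) : nat := `|(Num.floor (a x) + shift%:Z)%R|%N.+1.

Definition interval_place (x : G) : place :=
  Place (rank frac x) (column x) (cl x) (~~ cr x).

Lemma frac_itv x : (0 <= frac x < 1)%R.
Proof. by have := floor_itv (a x); rewrite /frac intrD; lra. Qed.

Lemma columnE x : ((column x)%:Z)%R = (Num.floor (a x) + shift%:Z + 1)%R.
Proof.
have : `|Num.floor (a x)|%N <= shift by rewrite /shift (bigD1 x) //= leq_addr.
by rewrite /column; lia.
Qed.

Lemma left_endpointE x : a x = (frac x + (column x)%:R - shift%:R - 1)%R.
Proof.
have -> : ((column x)%:R = (column x)%:Z%:~R :> R)%R by [].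
by rewrite columnE /frac !intrD /=; lra.
Qed.

Lemma natr1_ler (m n : nat) : m < n -> ((m%:R : R) + 1 <= n%:R)%R.
Proof. by move=> mn; rewrite natr1 ler_nat. Qed.

Lemma interval_place_adj x y : (a x <= a y)%R ->
  place_adj (interval_place x) (interval_place y) <->
  (a y < a x + 1)%R \/ a y = (a x + 1)%R /\ ~~ cr x /\ cl y.
Proof.
move=> axy; have [ax ay] := (left_endpointE x, left_endpointE y).
have [fx fy] := (frac_itv x, frac_itv y).
have col_le : column x <= column y.
  by rewrite leqNgt; apply/negP => /natr1_ler; lra.
have -> : place_adj (interval_place x) (interval_place y) =
    (column x == column y) || ((column x).+1 == column y) &&
      ((frac y < frac x)%R || [&& frac x == frac y, ~~ cr x & cl y]).
  rewrite /place_adj /place_next /= ltn_rank eq_rank; congr (_ || _).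
  by rewrite orb_idr // => /andP[/eqP e _]; lia.
rewrite ax ay; have [->|ne] := eqVneq (column x) (column y).
  by split=> // _; left; lra.
have [cxy|ne1] := eqVneq (column x).+1 (column y) => /=; last first.
  have /natr1_ler : (column x).+1 < column y by lia.
  by rewrite -natr1 => far; split=> // -[|[]]; lra.
have [lt|gt|->] := ltgtP (frac x) (frac y); rewrite -cxy -natr1 /=.
- by split=> // -[|[]]; lra.
- by split=> // _; left; lra.
- split=> [/andP[-> ->]|[|[_ [-> ->]]]] //; last by lra.
  by right; split=> //; lra.
Qed.

Lemma interval_placement : placement interval_place.
Proof.
move=> x y; wlog axy : x y / (a x <= a y)%R.
  move=> le_case; case/orP: (le_total (a x) (a y)) => /le_case // e.
  by rewrite sedge_sym e eq_sym place_adj_sym.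
apply/idP/andP => [/edgeE[/eqP xy]|[/eqP xy]].
  by move=> /(unit_intervals_meet _ _ _ _ axy)/(interval_place_adj axy).
move=> /(interval_place_adj axy)/(unit_intervals_meet _ _ _ _ axy) meet.
exact/edgeE.
Qed.

Lemma unit_intervals_cwd_le : cwd_le G (2 * alpha G + 3).
Proof.
apply/asboolP; have [|G0] := posnP #|G|; [by left | right].
pose le_key p q := (key p <= key q)%O.
pose ps := sort le_key [seq interval_place x | x : G].
have [||||t [_ t_expr t_def]] := build_k_expression (ps := ps)
  (k := \max_x column x) (occupied := fun j => [exists x, column x == j])
  interval_placement G0.
- by move=> j /existsP[x /eqP<-]; rewrite /= leq_bigmax.
- move=> j; split=> [/existsP[x /eqP]|[x <-]]; first by exists x.
  by apply/existsP; exists x.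
- by rewrite perm_sort.
- by rewrite sorted_map; apply: sort_sorted => p q; exact: le_total.
by exists t.
Qed.

End UnitIntervals.

Lemma cwd_leq (G : sgraph) k : cwd_le G k -> cwd G <= k.
Proof. by rewrite /cwd; case: ex_minnP => m _; apply. Qed.

Lemma mixed_unit_interval_cwd (R : realType) (G : sgraph) :
  mixed_unit_interval_graph R G -> cwd G <= 2 * alpha G + 3.
Proof.
move=> [I [I_unit edgeE]]; apply: cwd_leq.
have /choice[a /choice[cl /choice[cr IE]]] : forall x, exists a cl cr,
  I x = Interval (BSide cl a) (BSide cr (a + 1)%R) by [].
by apply: (@unit_intervals_cwd_le R G a cl cr) => x y; rewrite -!IE.
Qed.

Theorem theorem26 (R : realType) :
  (forall G : sgraph, mixed_unit_interval_graph R G ->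
     cwd G <= 2 * alpha G + 3) /\
  (exists (p : prog) (c : nat),
     forall (G : sgraph) (B : bubble_structure G) (l : seq place),
       mixed_unit_interval_graph R G -> bubble_model B -> listing B l ->
       exists (t : cwterm) (T : nat) (s : state),
         [/\ run (c * #|G|) p (init B l) T s,
             T <= c * #|G|,
             out s = code t,
             k_expression (2 * alpha G + 3) t
           & defines t G]).
Proof.
split; first exact: mixed_unit_interval_cwd.
by exists expression_prog, 300 => G B l _; exact: bubble_expression_prog.
Qed.
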